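(* Fix $q\in(0,1)$ and an admissible quadruple $(\alpha,\beta,\gamma,\delta)$, and let $M^{q,\alpha,\beta,\gamma,\delta}$ be the unique probability Borel measure on $\Omega$ such that the functions $\Phi_\lambda(X;q,\alpha,\beta,\gamma,\delta)$ ($\lambda$ ranging over partitions) form an orthogonal basis of $L^2(\Omega,M^{q,\alpha,\beta,\gamma,\delta})$. Then $M^{q,\alpha,\beta,\gamma,\delta}$ is concentrated on the subset $\Omega_\infty\subset\Omega$ of infinite configurations.
   Context: Let $\Delta_{q,\alpha,\beta}:=\{\beta^{-1}q,\beta^{-1}q^2,\dots\}\cup\{\alpha^{-1}q,\alpha^{-1}q^2,\dots\}\subset\mathbb{R}\setminus\{0\}$; $\Omega$ is the set of all subsets of $\Delta_{q,\alpha,\beta}$ with the product topology of $\{0,1\}^{\Delta_{q,\alpha,\beta}}$, and $\Omega_\infty$ the set of infinite subsets. A symmetric function $F$ (over $\mathbb{R}$) is evaluated at $X\in\Omega$ by substituting the points of $X$, followed by zeros if $X$ is finite. Admissible quadruple: $\alpha>0$, $\beta<0$, and either $\gamma=\bar\delta\in\mathbb{C}\setminus\mathbb{R}$, or $\gamma,\delta$ real lying together in one open interval between neighboring points of $\dots<\beta q^{-2}<\beta q^{-1}<0<\alpha q^{-1}<\alpha q^{-2}<\dots$. Notation: $(z;q)_n=\prod_{i=1}^n(1-zq^{i-1})$, $1/(q;q)_r:=0$ for $r<0$; $\ell(\lambda)$, $|\lambda|$, $\lambda'$ are length, size and transpose of a partition; $n(\lambda)=\sum_i(i-1)\lambda_i$.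 $\Phi_\lambda(\cdot\,;q,\alpha,\beta,\gamma,\delta)=\sum_{\nu\subseteq\lambda}\bigl(\sum_{\mu:\nu\subseteq\mu\subseteq\lambda}\rho(\lambda,\mu)\sigma(\mu,\nu)\bigr)S_\nu$ with $S_\nu$ the Schur functions, $$\rho(\lambda,\mu)=(-1)^{|\lambda|-|\mu|}\gamma^{-|\lambda|}\det\left[\frac{\left(\frac{\gamma}{\alpha}q^{\mu_k-k+2};q\right)_{r_{ik}}\left(\frac{\gamma}{\beta}q^{\mu_k-k+2};q\right)_{r_{ik}}}{q^{(\mu_k-k+1)r_{ik}}\left(\frac{\gamma\delta}{\alpha\beta}q^{\lambda_i+\mu_k-i-k+3};q\right)_{r_{ik}}(q;q)_{r_{ik}}}\right]_{i,k=1}^{\ell(\lambda)},\ r_{ik}=\lambda_i-\mu_k-i+k,$$ $$\sigma(\mu,\nu)=(-1)^{|\mu|-|\nu|}q^{n(\mu)-n(\mu')-n(\nu)+n(\nu')}\det\left[\frac{1}{(q;q)_{\mu_i-\nu_k-i+k}}\right]_{i,k=1}^{\ell(\mu)}.$$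
   Formalization: With Φ_λ as printed no such measure M exists; the theorem assumes that either the printed family or the corrected one (ρ without its sign (-1)^{|λ|-|μ|}, each S_ν multiplied by γ^{|ν|}) is an orthogonal basis of L²(Ω,M). *)

(* Defs.v *)
From HB Require Import structures.
From mathcomp Require Import all_boot all_order all_algebra.
From mathcomp Require Import all_classical all_reals all_analysis.
From mathcomp Require Import complex.

Set Implicit Arguments.
Unset Strict Implicit.
Unset Printing Implicit Defensive.

Import Order.TTheory GRing.Theory Num.Theory.
Import numFieldNormedType.Exports.

Local Open Scope classical_set_scope.
Local Open Scope ring_scope.

(** * Integer partitions *)

Definition is_intpart (la : seq nat) : bool :=
  sorted geq la && (0%N \notin la).

Definition intpart := {la : seq nat | is_intpart la}.

(* [0%N] is the value of [nth] past the end, as for the parts of a partition. *)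
Definition part (la : seq nat) (i : nat) : nat := nth 0%N la i.

Definition included (nu la : seq nat) : bool :=
  [forall i : 'I_(size nu), part nu i <= part la i]%N.

(* The [nu] with [included nu la] and first part at most [m]: see
   [mem_subparts_le]. *)
Fixpoint subparts_le (m : nat) (la : seq nat) : seq (seq nat) :=
  if la is a :: la' then
    [::] :: [seq i.+1 :: nu | i <- iota 0 (minn a m), nu <- subparts_le i.+1 la']
  else [:: [::]].

Definition subparts (la : seq nat) : seq (seq nat) := subparts_le (head 0%N la) la.

Lemma part_gt0 la i : is_intpart la -> (i < size la)%N -> (0 < part la i)%N.
Proof.
move=> /andP[_ h0] ilt; rewrite lt0n; apply: contraNneq h0 => <-.
exact: mem_nth.
Qed.

Lemma is_intpart_cons a la :
  is_intpart (a :: la) = [&& (0 < a)%N, (head 0%N la <= a)%N & is_intpart la].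
Proof.
have e x : (0 != x)%N = (0 < x)%N by rewrite lt0n eq_sym.
rewrite /is_intpart /= inE negb_or e.
case: la => [|b la] /=; first by rewrite andbT.
rewrite inE negb_or e; case: (0 < a)%N; last by rewrite andbF.
by rewrite /= -!andbA.
Qed.

Lemma included_nil la : included [::] la.
Proof. by apply/forallP => -[]. Qed.

Lemma included_cons b nu a la :
  included (b :: nu) (a :: la) = (b <= a)%N && included nu la.
Proof.
apply/forallP/andP => [h|[hb /forallP h] [[|i] hi] //=].
  split; first exact: (h ord0).
  by apply/forallP => i; exact: (h (lift ord0 i)).
exact: (h (Ordinal (hi : (i < size nu)%N))).
Qed.

Lemma mem_subparts_le m la nu :
  (nu \in subparts_le m la) = [&& is_intpart nu, included nu la & head 0%N nu <= m]%N.
Proof.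
elim: la m nu => [|a la IH] m [|b nu] //=; rewrite ?inE ?included_nil //=.
  apply/esym/negbTE/negP => /and3P[h /forallP /(_ ord0) /= + _].
  by rewrite leqNgt (part_gt0 (i := 0) h).
apply/allpairsPdep/idP => [[i [nu' [+ + [-> ->]]]]|].
  rewrite mem_iota IH /= add0n leq_min included_cons is_intpart_cons /=.
  by move=> /andP[-> ->] /and3P[-> -> ->].
rewrite is_intpart_cons included_cons.
case: b => [//|b] /and3P[/and3P[_ hd hnu] /andP[ba inc] bm].
by exists b, nu; rewrite mem_iota IH /= add0n leq_min ba bm hd hnu inc.
Qed.

Lemma mem_subparts la nu :
  (nu \in subparts la) = is_intpart nu && included nu la.
Proof.
rewrite mem_subparts_le; case: nu => [|b nu] /=; first by rewrite included_nil.
case: la => [|a la] /=; last by rewrite included_cons; case: (b <= a)%N; rewrite ?andbF ?andbT.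
case h: (is_intpart _) => //=; apply/andb_idr => /forallP /(_ ord0) /=.
by [].
Qed.

Lemma uniq_subparts_le m la : uniq (subparts_le m la).
Proof.
elim: la m => [|a la IH] m //=; apply/andP; split.
  by apply/negP => /allpairsPdep[i [nu [_ _]]].
apply: allpairs_uniq_dep => [|i _|]; [exact: iota_uniq|exact: IH|].
by move=> [i nu] [j mu] _ _ /= [-> ->].
Qed.

Lemma uniq_subparts la : uniq (subparts la).
Proof. exact: uniq_subparts_le. Qed.

Definition transpose (la : seq nat) : seq nat :=
  [seq count (fun a => j < a)%N la | j <- iota 0 (head 0%N la)].

(* Parts are numbered from 0 here, whence the factor [i] and not [i - 1]. *)
Definition nstat (la : seq nat) : nat := (\sum_(i < size la) i * part la i)%N.

(** * Schur functions, as sums over semistandard tableaux *)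

Definition cell (nu : seq nat) :=
  {c : 'I_(size nu) * 'I_(head 0%N nu) | (c.2 < part nu c.1)%N}.

Definition semistandard (nu : seq nat) (n : nat) (T : {ffun cell nu -> 'I_n}) : bool :=
  [forall c : cell nu, forall d : cell nu,
    [&& ((val c).1 == (val d).1) && ((val c).2 <= (val d).2)%N ==> (T c <= T d)%N
      & ((val c).2 == (val d).2) && ((val c).1 < (val d).1)%N ==> (T c < T d)%N]].

Definition schur (R : realType) (nu : seq nat) (x : seq R) : R :=
  \sum_(T : {ffun cell nu -> 'I_(size x)} | semistandard T) \prod_c x`_(T c).

(** * Configurations *)

(* The grid Delta is indexed by [bool * nat]; since beta < 0 < alpha and
   0 < q < 1, [grid_point q alpha beta] is a bijection from the index set to Delta. *)
Definition grid_index := (bool * nat)%type.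

Definition grid_point (R : realType) (q alpha beta : R) (i : grid_index) : R :=
  (if i.1 then beta else alpha)^-1 * q ^+ i.2.+1.

Definition Omega := prod_topology (fun _ : grid_index => bool).

Definition BorelOmega := g_sigma_algebraType (@open Omega).

Definition Omega_infty : set BorelOmega :=
  [set X : BorelOmega | infinite_set [set i : grid_index | X i]].

Definition points (R : realType) (q alpha beta : R) (X : Omega) (n : nat) : seq R :=
  [seq grid_point q alpha beta i
     | i <- [seq i <- [seq (b, k) | k <- iota 0 n, b <- [:: false; true]] | X i]].

(* Value at X of the symmetric function in infinitely many variables; for finite
   X the sequence is eventually constant, by stability of Schur polynomials under
   adding zero variables. *)
Definition schur_at (R : realType) (q alpha beta : R) (nu : seq nat) (X : Omega) : R :=
  lim (schur nu (points q alpha beta X n) @[n --> \oo]).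

(** * Admissible quadruples *)

Definition grid_ends (R : realType) (q alpha beta : R) : set R :=
  [set x | x = 0 \/ exists k : nat, x = alpha * q ^- k.+1 \/ x = beta * q ^- k.+1].

Definition neighbors (R : realType) (A : set R) (a b : R) : Prop :=
  [/\ A a, A b, a < b & forall c, A c -> ~ (a < c < b)].

Definition admissible (R : realType) (q alpha beta : R) (gamma delta : R[i]) : Prop :=
  [/\ 0 < alpha, beta < 0 &
      (gamma = (delta^*)%C /\ complex.Im gamma != 0) \/
      exists g d a b : R,
        [/\ gamma = g%:C%C, delta = d%:C%C, neighbors (grid_ends q alpha beta) a b,
            a < g < b & a < d < b]].

(** * Big q-Jacobi symmetric functions *)

Definition qpoch (F : fieldType) (z q : F) (n : nat) : F :=
  \prod_(i < n) (1 - z * q ^+ i).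

Section BigqJacobi.
Variables (R : realType) (q alpha beta : R) (gamma delta : R[i]).

Local Notation Q := (q%:C%C : R[i]).
Local Notation A := (alpha%:C%C : R[i]).
Local Notation B := (beta%:C%C : R[i]).

(* Here [i] and [k] are numbered from 1. *)
Definition rho_entry (la mu : seq nat) (i k : nat) : R[i] :=
  let l : int := (part la i.-1)%:Z in
  let m : int := (part mu k.-1)%:Z in
  match l - m - i%:Z + k%:Z with
  | Posz r =>
      qpoch (gamma / A * Q ^ (m - k%:Z + 2)) Q r *
      qpoch (gamma / B * Q ^ (m - k%:Z + 2)) Q r /
      (Q ^ ((m - k%:Z + 1) * r%:Z) *
       qpoch (gamma * delta / (A * B) * Q ^ (l + m - i%:Z - k%:Z + 3)) Q r *
       qpoch Q Q r)
  | Negz _ => 0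
  end.

Definition rho (la mu : seq nat) : R[i] :=
  (-1) ^ ((sumn la)%:Z - (sumn mu)%:Z) * gamma ^- sumn la *
  \det (\matrix_(i < size la, k < size la) rho_entry la mu i.+1 k.+1).

Definition sigma_entry (mu nu : seq nat) (i k : nat) : R[i] :=
  match (part mu i.-1)%:Z - (part nu k.-1)%:Z - i%:Z + k%:Z with
  | Posz r => (qpoch Q Q r)^-1
  | Negz _ => 0
  end.

Definition sigma (mu nu : seq nat) : R[i] :=
  (-1) ^ ((sumn mu)%:Z - (sumn nu)%:Z) *
  Q ^ ((nstat mu)%:Z - (nstat (transpose mu))%:Z
       - (nstat nu)%:Z + (nstat (transpose nu))%:Z) *
  \det (\matrix_(i < size mu, k < size mu) sigma_entry mu nu i.+1 k.+1).

Definition Phi_printed (la : intpart) (X : Omega) : R[i] :=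
  \sum_(nu <- subparts (val la))
    (\sum_(mu <- subparts (val la) | included nu mu) rho (val la) mu * sigma mu nu) *
    (schur_at q alpha beta nu X)%:C%C.

(* The published formula is [Phi_printed].  It has a superfluous sign
   (-1)^(|la| - |mu|) and lacks the factor gamma^|nu|, and no probability measure
   makes its members orthogonal when the parameters are admissible.  Expanding
   the one-variable polynomials
     3phi2(q^-n, (gamma delta / (alpha beta)) q^(n+1), gamma x;
           gamma q / alpha, gamma q / beta; q, q)
   with gamma, delta replaced by gamma q^(1-N), delta q^(1-N), first in the
   monic polynomials (y - 1)(y - q^-1) ... (y - q^(1-m)), y = gamma q^(1-N) x,
   and then in the powers of x, and letting N tend to infinity in the ratio of
   alternants, gives the coefficients below.  They are symmetric in gamma and
   delta and equal to 1 for nu = la, e.g. for la = (1):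
     S_1 + (- q / alpha - q / beta + (gamma + delta) q^2 / (alpha beta)) /
           ((1 - q) (1 - gamma delta q^2 / (alpha beta))). *)
Definition Phi (la : intpart) (X : Omega) : R[i] :=
  \sum_(nu <- subparts (val la))
    (\sum_(mu <- subparts (val la) | included nu mu)
       ((-1) ^ ((sumn (val la))%:Z - (sumn mu)%:Z) * rho (val la) mu) *
       (gamma ^+ sumn nu * sigma mu nu)) *
    (schur_at q alpha beta nu X)%:C%C.

End BigqJacobi.

(** * Orthogonal bases of the complex Hilbert space L^2 *)

Section L2.
Variables (R : realType) (d : measure_display) (T : measurableType d).
Variable M : probability T R.

Definition inL2 (f : T -> R[i]) : Prop :=
  (fun x => complex.Re (f x)) \in Lfun M 2%:E /\
  (fun x => complex.Im (f x)) \in Lfun M 2%:E.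

Definition cintegral (f : T -> R[i]) : R[i] :=
  ((\int[M]_x complex.Re (f x)) +i* (\int[M]_x complex.Im (f x)))%C.

Definition inner (f g : T -> R[i]) : R[i] :=
  cintegral (fun x => f x * (g x)^*%C).

Definition sqnorm (f : T -> R[i]) : R := complex.Re (inner f f).

Definition orthogonal_basis (I : Type) (F : I -> T -> R[i]) : Prop :=
  [/\ forall i, inL2 (F i),
      forall i, inner (F i) (F i) <> 0,
      forall i j, i <> j -> inner (F i) (F j) = 0 &
      forall g, inL2 g -> forall e : R, 0 < e ->
        exists (s : seq I) (c : I -> R[i]),
          sqnorm (fun x => g x - \sum_(i <- s) c i * F i x) < e].

End L2.

(* Main.v *)
Require Import Defs.
From mathcomp Require Import all_boot all_order all_algebra.
From mathcomp Require Import all_classical all_reals all_analysis.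
From mathcomp Require Import complex zify ring lra.

(** The decay rates are compared on the scale r = q^(1/4). Up to factors K^n, an atom X forces
    |Phi_(n)(X)| below r^(2 n^2). Undoing two steps of the recursion in k costs a factor q^-j, and
    since (j+2)^2 >= j^2 + 4j the total loss stays within r^-(n^2). The gap r^(n^2) swallows every
    exponential factor, so no constant has to be computed; [superexp] is a notion halfway between
    the two rates. The hook contributes nothing to the norms because it is orthogonal to every row.
    The three-term relation holds for the formal coefficients at every index, also beyond h_0; this
    carries the decay of Phi_(n)(X) over to the sums in which each h_k is replaced by h_(k+i), and
    the removal of points consumes these shifts. For admissible parameters c = gamma delta q^2 /
    (alpha beta) is negative, so the denominators 1 - c x with x >= 0 are at least 1. The parameters
    gamma, delta may be complex, but their sum and product are real, and division by powers of gamma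
    leaves coefficients that depend only on these. *)

(** Only the diagrams (n) and (n,1) enter. By Pieri's rule, h_1 Phi_(n) equals
    Phi_(n+1) + Phi_(n,1) + a_n Phi_(n) + b_n Phi_(n-1) up to a constant, with
    b_n = O(q^(2n)). Orthogonality then gives ||Phi_(n)||^2 = b_n ||Phi_(n-1)||^2,
    so ||Phi_(n)|| decays like q^(n^2/2), and so do the values of Phi_(n) at an
    atom X. If X is finite, the series sum_k h_k(X) t^k is a finite product of
    geometric series; stripping its N factors one at a time turns the decay of
    Phi_(n)(X) into the same decay of the formal coefficients of h_(-i) in
    Phi_(n), for i >= N. But the recursion in k of the coefficients of h_k in
    Phi_(n) starts from 1 at k = n, and when it is run backwards it loses only a
    factor q^(-n^2/4). Hence no finite configuration is an atom, and there are
    countably many of them.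

    With the coefficients as printed, orthogonality to 1 determines the moments
    E[h_k]. It yields numbers t_m with t_(m+1) / t_m -> 1, while the bounds on h_k
    force t_(m+1) + t_m to be much smaller than t_m; so no such measure exists. *)

Set Implicit Arguments.
Unset Strict Implicit.
Unset Printing Implicit Defensive.

Import Order.TTheory GRing.Theory Num.Theory.
Import numFieldNormedType.Exports.

Local Open Scope classical_set_scope.
Local Open Scope ring_scope.

(** * Schur functions of rows and hooks *)

(** For k = 0 this is the empty partition, since partitions have no zero parts. *)
Definition row_part (k : nat) : seq nat := nseq (0 < k) k.

(** Complete homogeneous polynomials, defined by the recursion that splits off the factor 1 / (1 - x
    t) of the generating series; [hconv_cons] later removes points through it. *)
Fixpoint hsym (R : pzRingType) (s : seq R) : nat -> R :=
  match s with
  | [::] => fun k => (k == 0)%:R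
  | x :: s' => fix aux k :=
      match k with
      | 0%N => 1
      | k'.+1 => x * aux k' + hsym s' k'.+1
      end
  end.

Section Hsym.
Variable R : comPzRingType.
Implicit Types (s : seq R) (x : R).

Lemma hsym0 s : hsym s 0 = 1. Proof. by case: s. Qed.

Lemma hsym_cons x s k : hsym (x :: s) k.+1 = x * hsym (x :: s) k + hsym s k.+1.
Proof. by []. Qed.

(** An instance of symmetry, needed because [points] grows at its right end. *)
Lemma hsym_rcons s x k :
  hsym (rcons s x) k.+1 = x * hsym (rcons s x) k + hsym s k.+1.
Proof.
elim: s k => [|y s IH] k //.
rewrite rcons_cons; elim: k => [|k IHk].
  by rewrite !hsym_cons !hsym0 IH hsym0; ring.
by rewrite hsym_cons {1}IHk IH (hsym_cons y s k.+1) (hsym_cons y (rcons s x) k); ring.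
Qed.

(** Monomials are sorted by their smallest index i; the other k variables then have index at least
    i. *)
Lemma hsym_drop s v k :
  hsym (drop v s) k.+1 = \sum_(i < size s | (v <= i)%N) s`_i * hsym (drop i s) k.
Proof.
elim: s v => [|x s IH] [|v]; rewrite ?big_ord0 //=.
- rewrite big_ord_recl /=; have := IH 0%N; rewrite drop0 => ->.
  by congr (_ + _); apply: eq_big => // i.
- by rewrite IH big_mkcond [RHS]big_mkcond /= big_ord_recl /= add0r.
Qed.

Lemma sum_path_hsym s v k :
  \sum_(t : k.-tuple 'I_(size s) | path leq v (map val t)) \prod_(i <- t) s`_i =
  hsym (drop v s) k.
Proof.
elim: k v => [|k IH] v.
  rewrite hsym0 (big_pred1 [tuple]) ?big_nil // => t.
  by rewrite (tuple0 t) /= eqxx.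
rewrite hsym_drop.
under [RHS]eq_bigr => i _ do rewrite -IH big_distrr /=.
rewrite pair_big_dep /=.
rewrite (reindex (fun p : 'I_(size s) * k.-tuple 'I_(size s) => [tuple of p.1 :: p.2])) /=.
  by apply: eq_big => [[i t]|[i t] _] //=; rewrite big_cons.
exists (fun t : k.+1.-tuple _ => (thead t, [tuple of behead t])) => [[i t] _|t _] /=.
  by congr (_, _); apply: val_inj.
by rewrite [RHS]tuple_eta.
Qed.

End Hsym.

Section SchurHook.
Variable R : realType.
Implicit Type s : seq R.

Lemma schur_nil s : schur [::] s = 1.
Proof.
have cellP (c : cell [::]) : False by case: c => -[[]].
rewrite /schur (big_pred1 [ffun c => False_rect _ (cellP c)]) => [|T].
  by rewrite big1 // => c; case: (cellP c).
have -> : T = [ffun c => False_rect _ (cellP c)] by apply/ffunP => c; case: (cellP c).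
by rewrite /pred1 /= eqxx; apply/forallP => c; case: (cellP c).
Qed.

Lemma sorted_tnthP n k (t : k.-tuple 'I_n) :
  reflect (forall i j : 'I_k, (i <= j)%N -> (tnth t i <= tnth t j)%N)
          (sorted leq (map val t)).
Proof.
apply: (iffP idP) => [srt i j ij|h].
  have := sorted_leq_nth leq_trans leqnn 0%N srt.
  move=> /(_ i j); rewrite !inE size_map size_tuple !ltn_ord => /(_ isT isT ij).
  by rewrite !(nth_map (tnth t i)) ?size_tuple // -!tnth_nth.
apply/(sortedP 0%N) => i; rewrite size_map size_tuple => ik.
have ik' := ltnW ik; pose x0 := tnth t (Ordinal ik).
rewrite !(nth_map x0) ?size_tuple //.
by have := h (Ordinal ik') (Ordinal ik) (leqnSn i); rewrite 2!(tnth_nth x0).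
Qed.

Section Row.
Variable k : nat.

Lemma row_cell_subproof (j : 'I_k.+1) : (j < part [:: k.+1] (ord0 : 'I_1))%N.
Proof. exact: ltn_ord. Qed.

Definition row_cell (j : 'I_k.+1) : cell [:: k.+1] :=
  exist _ (ord0 : 'I_(size [:: k.+1]), j : 'I_(head 0%N [:: k.+1])) (row_cell_subproof j).

Lemma row_cellK (c : cell [:: k.+1]) : row_cell (val c).2 = c.
Proof. by apply: val_inj; case: c => -[i j] /= h; rewrite (ord1 i). Qed.

Lemma schur_rowS s : schur [:: k.+1] s = hsym s k.+1.
Proof.
rewrite -[s in RHS]drop0 -sum_path_hsym /schur.
rewrite (reindex (fun t : k.+1.-tuple 'I_(size s) =>
  [ffun c : cell [:: k.+1] => tnth t (val c).2])); last first.
  exists (fun T : {ffun cell [:: k.+1] -> _} => [tuple T (row_cell j) | j < k.+1]) => [t _|T _].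
    by apply: eq_from_tnth => j; rewrite tnth_mktuple ffunE.
  by apply/ffunP => c; rewrite ffunE tnth_mktuple row_cellK.
apply: eq_big => [t|t _].
  have -> : path leq 0 (map val t) = sorted leq (map val t) by case: (map _ t).
  apply/forallP/sorted_tnthP => [h i j ij|h c].
    have /forallP/(_ (row_cell j)) := h (row_cell i).
    by rewrite !ffunE /= ij /= => /andP[].
  apply/forallP => d; rewrite !ffunE; apply/andP; split; apply/implyP => /andP[h1 h2].
    exact: h.
  by move: h2; rewrite (ord1 (val c).1) (ord1 (val d).1).
rewrite big_tuple (reindex row_cell) /=; last first.
  by exists (fun c => (val c).2) => [//|c _]; exact: row_cellK.
by apply: eq_bigr => j _; rewrite ffunE.
Qed.

End Row.

Lemma schur_row s k : schur (row_part k) s = hsym s k.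
Proof. by case: k => [|k]; [rewrite hsym0 schur_nil | rewrite schur_rowS]. Qed.

Section Hook.
Variable k : nat.
Let nu := [:: k.+1; 1%N].

Lemma hook_arm_subproof (j : 'I_k.+1) : (j < part nu (ord0 : 'I_2))%N.
Proof. exact: ltn_ord. Qed.

Definition hook_arm (j : 'I_k.+1) : cell nu :=
  exist _ (ord0 : 'I_(size nu), j : 'I_(head 0%N nu)) (hook_arm_subproof j).

Definition hook_leg : cell nu :=
  exist (fun c : 'I_(size nu) * 'I_(head 0%N nu) => (c.2 < part nu c.1)%N)
    (ord_max : 'I_2, ord0 : 'I_k.+1) (erefl true).

Lemma hook_cellP (c : cell nu) : c = hook_leg \/ c = hook_arm (val c).2.
Proof.
case: c => -[[[|[|//]] hi] j] /= h; [right|left]; apply: val_inj => /=;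
  congr (_, _); apply: val_inj => //=.
by move: h; rewrite /part /=; case: (nat_of_ord j).
Qed.

(** A tableau of hook shape is a weakly increasing word for the arm together with a leg entry
    strictly greater than its first letter. If the leg entry is at most that letter, prepending it
    gives a weakly increasing word of length k + 2; these pairs are subtracted from the product. *)
Lemma schur_hook s :
  schur nu s = hsym s 1 * hsym s k.+1 - hsym s k.+2.
Proof.
pose n := size s.
have drop_hsym j : hsym s j = \sum_(t : j.-tuple 'I_n | sorted leq (map val t))
    \prod_(i <- t) s`_i.
  rewrite -[s in LHS]drop0 -sum_path_hsym; apply: eq_bigl => t.
  by case: (map _ t).
have -> : hsym s 1 * hsym s k.+1 = \sum_(p : 'I_n * k.+1.-tuple 'I_n |
    sorted leq (map val p.2)) s`_p.1 * \prod_(i <- p.2) s`_i.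
  have -> : hsym s 1 = \sum_(i < n) s`_i.
    by rewrite -[s in LHS]drop0 hsym_drop; apply: eq_bigr => i _; rewrite hsym0 mulr1.
  by rewrite drop_hsym mulr_suml; under eq_bigr => i _ do rewrite mulr_sumr;
     rewrite pair_big_dep.
rewrite (bigID (fun p : 'I_n * k.+1.-tuple 'I_n => (p.1 <= thead p.2)%N)) /=.
rewrite [X in X + _ - _](_ : _ = hsym s k.+2); last first.
  rewrite drop_hsym.
  rewrite [RHS](reindex (fun p : 'I_n * k.+1.-tuple 'I_n => [tuple of p.1 :: p.2])) /=.
    apply: eq_big => [[i t]|[i t] _] /=; last by rewrite big_cons.
    by case/tupleP: t => j t /=; rewrite theadE andbC.
  exists (fun t : k.+2.-tuple _ => (thead t, [tuple of behead t])) => [[i t] _|t _] /=.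
    by congr (_, _); apply: val_inj.
  by rewrite [RHS]tuple_eta.
rewrite addrAC subrr add0r /schur.
rewrite (reindex (fun p : 'I_n * k.+1.-tuple 'I_n =>
  [ffun c : cell nu => if c == hook_leg then p.1 else tnth p.2 (val c).2])); last first.
  exists (fun T : {ffun cell nu -> _} => (T hook_leg, [tuple T (hook_arm j) | j < k.+1])) => [[i t] _|T _].
    congr (_, _); first by rewrite ffunE eqxx.
    by apply: eq_from_tnth => j; rewrite tnth_mktuple ffunE.
  apply/ffunP => c; rewrite ffunE; case: eqP => [->//|ne].
  by rewrite tnth_mktuple; case: (hook_cellP c) => [//|<-].
apply: eq_big => [[v t]|[v t] _] /=.
  rewrite -ltnNge; apply/forallP/andP => [h|[/sorted_tnthP h tv] c].
    split.
      apply/sorted_tnthP => i j ij.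
      have /forallP/(_ (hook_arm j)) := h (hook_arm i).
      by rewrite !ffunE /= ij /= => /andP[].
    by have /forallP/(_ hook_leg) := h (hook_arm ord0); rewrite !ffunE.
  apply/forallP => d; rewrite !ffunE.
  case: (hook_cellP c) => ->; case: (hook_cellP d) => -> //=.
  - by rewrite leqnn.
  - by rewrite andbF.
  - rewrite andbT; apply/implyP => /eqP ->; exact: tv.
  - by rewrite andbF andbT; apply/implyP; exact: h.
rewrite (bigD1 hook_leg) //= ffunE eqxx; congr (_ * _).
rewrite big_tuple (reindex_onto hook_arm (fun c : cell nu => (val c).2)) /=.
  by apply: eq_big => [j|j _]; rewrite ?ffunE //= eqxx.
by move=> c /eqP ne; case: (hook_cellP c).
Qed.

End Hook.
End SchurHook.

Lemma cvg_of_geometric_steps (R : realType) (u : R^nat) (q D : R) :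
  0 < q < 1 -> (forall n, `|u n.+1 - u n| <= D * q ^+ n) -> cvgn u.
Proof.
move=> /andP[q0 q1] hu.
have q1' : `|q| < 1 by rewrite gtr0_norm.
have hs : cvgn (series (telescope u)).
  apply: normed_cvg; apply: (@series_le_cvg _ _ (geometric D q)).
  - by move=> n; exact: normr_ge0.
  - by move=> n; apply: le_trans (normr_ge0 _) (hu n).
  - by move=> n; exact: hu.
  - exact: is_cvg_geometric_series.
have -> : u = (fun n => u 0%N + series (telescope u) n).
  by apply/funext => n; rewrite eq_sum_telescope.
by apply: is_cvgD => //; exact: is_cvg_cst.
Qed.

(** * Estimates for complete symmetric polynomials *)

Section HsymBounds.
Variable R : realDomainType.
Implicit Type s t : seq R.

Lemma hsym_le s k : `|hsym s k| <= (\sum_(x <- s) `|x|) ^+ k.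
Proof.
elim: s k => [|x s IH] k; first by rewrite big_nil expr0n normr_nat.
rewrite big_cons; set S := \sum_(j <- s) _ in IH *.
have S0 : 0 <= S by apply: sumr_ge0 => *; exact: normr_ge0.
elim: k => [|k IHk]; first by rewrite hsym0 normr1 expr0.
rewrite hsym_cons (le_trans (ler_normD _ _)) // exprS mulrDl lerD //.
  by rewrite normrM ler_wpM2l.
apply: le_trans (IH _) _; rewrite exprS ler_wpM2l //.
by apply: lerXn2r; rewrite ?nnegrE ?addr_ge0 ?lerDr ?normr_ge0.
Qed.

(** Points are appended one at a time; by [hsym_rcons] a new point y changes h_k by y h_(k-1). *)
Lemma hsym_cat_sub s t k (C : R) : 1 <= C -> \sum_(x <- s ++ t) `|x| <= C ->
  `|hsym (s ++ t) k - hsym s k| <= (\sum_(x <- t) `|x|) * C ^+ k.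
Proof.
move=> C1; have C0 : 0 <= C by apply: le_trans C1.
elim: t s => [|y t IH] s hC; first by rewrite cats0 subrr normr0 big_nil mul0r.
rewrite -cat_rcons in hC *; rewrite big_cons mulrDl [leRHS]addrC.
rewrite -(subrKA (hsym (rcons s y) k)).
apply: le_trans (ler_normD _ _) (lerD (IH _ hC) _).
case: k {IH} => [|k]; first by rewrite !hsym0 subrr normr0 mulr_ge0.
rewrite hsym_rcons addrK normrM ler_wpM2l //.
apply: le_trans (hsym_le _ _) _.
have hs : \sum_(x <- rcons s y) `|x| <= C.
  apply: le_trans hC; rewrite big_cat /= lerDl.
  by apply: sumr_ge0 => *; exact: normr_ge0.
apply: (@le_trans _ _ (C ^+ k)); last by rewrite exprS ler_peMl ?exprn_ge0.
by apply: lerXn2r; rewrite ?nnegrE //; apply: sumr_ge0 => *; exact: normr_ge0.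
Qed.

End HsymBounds.

(** * Complete symmetric functions of a configuration *)

Section Points.
Variables (R : realType) (q alpha beta : R).
Hypothesis hq : 0 < q < 1.
Implicit Type X : Omega.

Local Notation pts := (points q alpha beta).

Definition complete_at X k : R := lim (hsym (pts X n) k @[n --> \oo]).

Lemma pointsS X n :
  pts X n.+1 = pts X n ++ [seq grid_point q alpha beta i
                          | i <- [seq i <- [:: (false, n); (true, n)] | X i]].
Proof.
rewrite /points -map_cat -filter_cat -addn1 iotaD add0n.
by rewrite allpairs_cat.
Qed.

Local Notation W := (`|alpha^-1| + `|beta^-1|).

Lemma grid_point_le i : `|grid_point q alpha beta i| <= W * q ^+ i.2.
Proof.
case/andP: hq => q0 q1.
rewrite /grid_point normrM; apply: ler_pM => //.
  by case: i => -[] n /=; rewrite /W ?lerDr ?lerDl.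
rewrite ger0_norm ?exprn_ge0 ?(ltW q0) // exprS.
by rewrite ger_pMl ?exprn_gt0 // (ltW q1).
Qed.

Lemma points_step X n :
  \sum_(x <- [seq grid_point q alpha beta i
     | i <- [seq i <- [:: (false, n); (true, n)] | X i]]) `|x| <= 2 * W * q ^+ n.
Proof.
have W0 : 0 <= W by rewrite addr_ge0.
have q0 : 0 <= q by case/andP: hq => /ltW.
have h b := grid_point_le (b, n); have := h true; have := h false => /= h1 h2.
have p0 : 0 <= W * q ^+ n by rewrite mulr_ge0 ?exprn_ge0.
move: p0 h1 h2; set p := W * q ^+ n => p0 h1 h2.
rewrite -mulrA -/p /=; case: (X (false, n)); case: (X (true, n));
  rewrite /= ?big_cons big_nil; lra.
Qed.

(** Each level n of the grid holds two points of modulus at most W q^n, which gives the geometric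
    sum; the summand 1 keeps the bound at least 1, so that its powers increase. *)
Definition points_bound := 1 + 2 * W / (1 - q).

Lemma points_bound_ge1 : 1 <= points_bound.
Proof.
case/andP: hq => q0 q1; have W0 : 0 <= W by rewrite addr_ge0.
by rewrite /points_bound lerDl divr_ge0 ?mulr_ge0 // subr_ge0 ltW.
Qed.

Lemma sum_points_le X n : \sum_(x <- pts X n) `|x| <= points_bound.
Proof.
case/andP: hq => q0 q1; have q1' : 0 < 1 - q by lra.
have W0 : 0 <= W by rewrite addr_ge0.
(* The partial geometric sum is kept exact, since the bare bound is not inductive. *)
suff : \sum_(x <- pts X n) `|x| <= 2 * W / (1 - q) * (1 - q ^+ n).
  move=> /le_trans; apply; rewrite /points_bound -[leLHS]add0r lerD //.
  rewrite ler_piMr ?divr_ge0 ?mulr_ge0 // ?(ltW q1') //.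
  by rewrite gerBl exprn_ge0 ?(ltW q0).
elim: n => [|n IH]; first by rewrite /points big_nil expr0 subrr mulr0.
rewrite pointsS big_cat /=.
apply: le_trans (lerD IH (points_step X n)) _.
by rewrite le_eqVlt; apply/orP; left; apply/eqP; rewrite exprS; field; lra.
Qed.

Lemma is_cvg_hsym_points X k : cvgn (fun n => hsym (pts X n) k).
Proof.
apply: (@cvg_of_geometric_steps _ _ q (2 * W * points_bound ^+ k)) => // n.
have h := sum_points_le X n.+1; rewrite pointsS in h *.
apply: le_trans (hsym_cat_sub k points_bound_ge1 h) _.
rewrite mulrAC ler_wpM2r ?points_step // exprn_ge0 //.
by apply: le_trans points_bound_ge1.
Qed.

Lemma complete_at_le X k : `|complete_at X k| <= points_bound ^+ k.
Proof.
have c := @is_cvg_hsym_points X k.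
rewrite /complete_at -lim_norm //; apply: limr_le; first exact: is_cvg_norm.
apply: nearW => n; apply: le_trans (hsym_le _ _) _.
apply: lerXn2r; rewrite ?nnegrE ?sum_points_le //.
  by apply: sumr_ge0 => *; exact: normr_ge0.
by apply: le_trans points_bound_ge1.
Qed.

Lemma complete_at0 X : complete_at X 0 = 1.
Proof.
rewrite /complete_at; under eq_fun do rewrite hsym0.
exact: lim_cst.
Qed.

Lemma schur_at_row X k : schur_at q alpha beta (row_part k) X = complete_at X k.
Proof. by rewrite /schur_at /complete_at; under eq_fun do rewrite schur_row. Qed.

Lemma schur_at_hook X k : schur_at q alpha beta [:: k.+1; 1%N] X =
  complete_at X 1 * complete_at X k.+1 - complete_at X k.+2.
Proof.
rewrite /schur_at; under eq_fun do rewrite schur_hook.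
have c := @is_cvg_hsym_points X.
apply: cvg_lim => //; apply: cvgB; last exact: c.
by apply: cvgM; exact: c.
Qed.

Lemma complete_at_finite X : finite_set [set i | X i] ->
  exists s : seq R, forall k, complete_at X k = hsym s k.
Proof.
move=> fX; have [n hn] : exists n, forall i, X i -> (i.2 < n)%N.
  have [s hs] := (finite_seqP _).1 fX.
  exists (\max_(i <- s) i.2).+1 => i Xi; rewrite ltnS.
  have : [set i | X i] i by [].
  by rewrite hs /= => si; apply: leq_bigmax_seq.
have stat m : (n <= m)%N -> pts X m = pts X n.
  elim: m => [|m IH]; first by rewrite leqn0 => /eqP ->.
  rewrite leq_eqVlt => /orP[/eqP ->//|]; rewrite ltnS => nm.
  rewrite pointsS (_ : [seq i <- _ | X i] = [::]) ?cats0 ?IH //.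
  apply/eqP; rewrite -(negbK (_ == _)) -has_filter; apply/hasPn => i.
  by rewrite !inE => /orP[] /eqP ->; apply/negP => /hn /=; rewrite ltnNge nm.
exists (pts X n) => k; apply: lim_near_cst => //.
by exists n => // m /= nm; rewrite stat.
Qed.

End Points.

(** * The coefficients of one-row functions *)

Section OneRow.
Variables (F : fieldType) (q a b c : F).
Implicit Types (Q W : F).

(* With a = gamma q / alpha, b = gamma q / beta, c = gamma delta q^2 / (alpha beta)
   and Q = q^n: up to powers of gamma and signs, [dcoef Q i] is rho of the rows
   n, n - i, and [scoef W l], W = q^m, is sigma of the rows m, m - l. *)
Fixpoint dcoef Q i : F :=
  if i is i'.+1 then
    dcoef Q i' * ((1 - a * (Q / q ^+ i'.+1)) * (1 - b * (Q / q ^+ i'.+1)) * q ^+ i' * q ^+ i'.+1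
      / (Q * (1 - q ^+ i'.+1) * (1 - c * Q ^+ 2 / q ^+ i'.+2)))
  else 1.

Fixpoint scoef W l : F :=
  if l is l'.+1 then scoef W l' * (- q ^+ l'.+1 / (W * (1 - q ^+ l'.+1))) else 1.

(** For Q = q^n and j <= n this is, up to a power of gamma, the coefficient of h_(n-j) in Phi_(n),
    summed over the intermediate rows n - i. The formula is rational in Q and makes sense for j > n
    too. *)
Definition pcoef Q j : F :=
  \sum_(i < j.+1) dcoef Q i * scoef (Q / q ^+ i) (j - i).

(** The value forced by the three-term relation at j = 1: by [pcoef1] it is
    [pcoef Q 1 - pcoef (q * Q) 1]. *)
Definition three_term_a Q : F :=
  ((a * b + c) * (Q / q) - (a + b)) / ((1 - q) * (1 - c * (Q / q) ^+ 2))
  - ((a * b + c) * Q - (a + b)) / ((1 - q) * (1 - c * Q ^+ 2)).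

Definition three_term_b Q : F :=
  c / q * (Q / q) ^+ 2 * (1 - a * (Q / q)) * (1 - b * (Q / q))
    * (a - c * (Q / q)) * (b - c * (Q / q))
  / ((1 - c * (Q / q) ^+ 2 / q) * (1 - c * (Q / q) ^+ 2) ^+ 2 * (1 - c * (Q / q) ^+ 2 * q)).

(** No denominator 1 - c Q^2 q^m vanishes, for any integer m. Splitting m into k - i avoids negative
    exponents and makes the condition stable under Q -> q Q and Q -> Q / q. *)
Definition generic Q := Q != 0 /\ forall i k, q ^+ i - c * Q ^+ 2 * q ^+ k != 0.

Hypothesis q0 : q != 0.
Hypothesis hq : forall i, 1 - q ^+ i.+1 != 0.

Let q1 : 1 - q != 0. Proof. exact: (hq 0). Qed.

Lemma genericM Q : generic Q -> generic (q * Q).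
Proof.
move=> [Q0 h]; split; first by rewrite mulf_neq0.
move=> i k; have := h i k.+2.
by congr (_ != 0); congr (_ - _); rewrite !exprSr exprMn; ring.
Qed.

Lemma genericV Q : generic Q -> generic (Q / q).
Proof.
move=> [Q0 h]; split; first by rewrite mulf_neq0 ?invr_neq0.
move=> i k; have := h i.+2 k; apply: contra_neq => e.
have -> : q ^+ i.+2 - c * Q ^+ 2 * q ^+ k =
  q ^+ 2 * (q ^+ i - c * (Q / q) ^+ 2 * q ^+ k).
  by rewrite !exprSr; field.
by rewrite e mulr0.
Qed.

Lemma scoefM W l : W != 0 -> scoef (W / q) l = q ^+ l * scoef W l.
Proof.
move=> W0; elim: l => [|l IH]; first by rewrite expr0 mul1r.
rewrite /= IH !exprSr; have := hq l; rewrite exprSr => hl.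
by field; rewrite q0 W0 hl.
Qed.

(** Reduces neighbouring values of Q to one of them, so that [dcoef_three] becomes a rational
    identity. *)
Lemma dcoef_shift Q i : generic Q -> dcoef (q * Q) i.+1 =
  dcoef Q i * ((1 - a * Q) * (1 - b * Q) * (1 - c * Q ^+ 2 / q ^+ i.+1) * q ^+ i
   / (Q * (1 - q ^+ i.+1) * (1 - c * Q ^+ 2 / q) * (1 - c * Q ^+ 2))).
Proof.
move=> [Q0 h]; elim: i => [|i IH].
  have := h 1%N 0%N; have := h 0%N 0%N; rewrite /= !expr0 !mulr1 expr1 => h0 h1.
  field.
  by rewrite q0 Q0 q1 /= h0 h1.
rewrite [LHS]/= -[X in X * _]/(dcoef (q * Q) i.+1) IH [dcoef Q i.+1]/=.
have := h 1%N 0%N; have := h 0%N 0%N; rewrite /= !expr0 !mulr1 expr1 => h0 h1.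
have := h i.+1 0%N; have := h i.+2 0%N; have := hq i; have := hq i.+1.
rewrite !(exprSr q) !expr0 !mulr1; have := expf_neq0 i q0.
set z := q ^+ i => z0 h2 h3 h4 h5; field.
by rewrite q0 Q0 z0 h0 h1 h2 h3 h4 h5.
Qed.

(** By [dcoef_shift] every term is a multiple of [dcoef (Q / q) i], and a rational identity in q^i
    remains. The second term on the left is the one created by the re-expansion in
    [pcoef_shifted]. *)
Lemma dcoef_three Q i : generic Q ->
  dcoef Q i.+2 + q ^+ i.+1 / Q * dcoef Q i.+1 =
  dcoef (q * Q) i.+2 + three_term_a Q * dcoef Q i.+1 + three_term_b Q * dcoef (Q / q) i.
Proof.
move=> gQ; have gQ' := genericV gQ; case: (gQ) => Q0 h.
rewrite (dcoef_shift i.+1 gQ) [dcoef Q i.+2]/= -[X in X * _]/(dcoef Q i.+1).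
have -> : dcoef Q i.+1 = dcoef (q * (Q / q)) i.+1 by rewrite mulrC divfK.
rewrite (dcoef_shift i gQ') /three_term_a /three_term_b.
have := h 0%N 0%N; have := h 0%N 1%N; have := h 1%N 0%N; have := h 2 0%N; have := h 3 0%N.
have := h i.+1 0%N; have := h i.+2 0%N; have := h i.+3 0%N; have := hq i; have := hq i.+1.
rewrite !(exprSr q) !expr0 !mul1r !mulr1; have := expf_neq0 i q0.
set z := q ^+ i => z0 h1 h2 h3 h4 h5 h6 h7 h8 h9 h10.
rewrite -!expr2 in h6 h7; field.
by rewrite q0 Q0 z0 q1 h1 h2 h3 h6 h7 h8 h10.
Qed.

Lemma dcoef_three1 Q : generic Q -> dcoef Q 1 + Q^-1 = dcoef (q * Q) 1 + three_term_a Q.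
Proof.
move=> gQ; case: (gQ) => Q0 h; rewrite (dcoef_shift 0 gQ) /three_term_a /=.
have := h 0%N 0%N; have := h 1%N 0%N; have := h 2 0%N.
rewrite !(exprSr q) !expr0 !mul1r !mulr1 => h1 h2 h3.
rewrite -?expr2 in h3 *; field.
by rewrite q0 Q0 q1 h1 h2 h3.
Qed.

Lemma pcoef0 Q : pcoef Q 0 = 1.
Proof. by rewrite /pcoef big_ord1 /= mulr1. Qed.

Lemma pcoef1 Q : generic Q ->
  pcoef Q 1 = ((a * b + c) * (Q / q) - (a + b)) / ((1 - q) * (1 - c * (Q / q) ^+ 2)).
Proof.
move=> [Q0 h]; rewrite /pcoef big_ord_recr big_ord1 /=.
have := h 2 0%N; rewrite !(exprSr q) !expr0 !mul1r !mulr1 => h1.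
rewrite -expr2 in h1; field.
by rewrite q0 Q0 q1 h1 oner_neq0.
Qed.

(** Formally, the series of [scoef W l] times y^-l is the product of 1 - q^i / (W y) over i >= 1
    (Euler); passing from W to q W adds the factor 1 - 1 / (W y). *)
Lemma scoef_mulq W l : W != 0 ->
  scoef W l.+1 = scoef (q * W) l.+1 + W^-1 * scoef W l.
Proof.
move=> W0.
have e k : scoef W k = q ^+ k * scoef (q * W) k.
  by rewrite -scoefM ?mulf_neq0 // [q * W]mulrC mulfK.
rewrite !e /= (exprSr q); have := hq l; rewrite exprSr => h.
by field;  rewrite q0 W0 h.
Qed.

(** If J_m is y^m times the series of [scoef] at W = q^m, then y J_m = J_(m+1) + q^-m J_m. Applied
    termwise, this re-expands the sum in the indices occurring in [pcoef (q * Q)]. *)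
Lemma pcoef_shifted Q j : Q != 0 ->
  pcoef Q j = scoef (q * Q) j +
    \sum_(i < j) (dcoef Q i.+1 + q ^+ i / Q * dcoef Q i) * scoef (Q / q ^+ i) (j - i.+1).
Proof.
move=> Q0; under [in RHS]eq_bigr do rewrite mulrDl.
rewrite big_split /= addrA /pcoef.
have -> : scoef (q * Q) j + \sum_(i < j) dcoef Q i.+1 * scoef (Q / q ^+ i) (j - i.+1)
    = \sum_(i < j.+1) dcoef Q i * scoef (q * Q / q ^+ i) (j - i).
  rewrite big_ord_recl /= expr0 divr1 subn0 mul1r; congr (_ + _).
  apply: eq_bigr => i _; rewrite /bump /= add1n; congr (_ * scoef _ _).
  by rewrite exprS; field; rewrite q0 expf_neq0.
rewrite !big_ord_recr /= subnn !mulr1 addrAC -big_split /=; congr (_ + _).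
apply: eq_bigr => -[i ij] _ /=.
have W0 : Q / q ^+ i != 0 by rewrite mulf_neq0 ?invr_neq0 ?expf_neq0.
rewrite -(subnSK ij) scoef_mulq // mulrA.
by field; rewrite Q0 expf_neq0.
Qed.

Lemma pcoef_three Q j : generic Q ->
  pcoef Q j.+2 = pcoef (q * Q) j.+2 + three_term_a Q * pcoef Q j.+1 + three_term_b Q * pcoef (Q / q) j.
Proof.
move=> gQ; have [Q0 _] := gQ.
have eQ i : q * Q / q ^+ i.+1 = Q / q ^+ i.
  by rewrite exprS; field; rewrite q0 expf_neq0.
have -> : pcoef (q * Q) j.+2 = scoef (q * Q) j.+2 + (dcoef (q * Q) 1 * scoef Q j.+1 +
    \sum_(i < j.+1) dcoef (q * Q) i.+2 * scoef (Q / q ^+ i.+1) (j - i)).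
  rewrite /pcoef [LHS]big_ord_recl [X in _ + X = _]big_ord_recl mul1r !subn0 expr0 divr1; congr (_ + (_ + _)).
    by rewrite -[nat_of_ord _]/1%N eQ expr0 divr1 subSS subn0.
  by apply: eq_bigr => i _; rewrite eQ.
have -> : pcoef Q j.+1 = scoef Q j.+1 +
    \sum_(i < j.+1) dcoef Q i.+1 * scoef (Q / q ^+ i.+1) (j - i).
  by rewrite /pcoef big_ord_recl mul1r subn0 expr0 divr1.
have -> : pcoef (Q / q) j =
    \sum_(i < j.+1) dcoef (Q / q) i * scoef (Q / q ^+ i.+1) (j - i).
  apply: eq_bigr => i _; congr (_ * scoef _ _).
  by rewrite exprS; field; rewrite q0 expf_neq0.
rewrite pcoef_shifted // big_ord_recl expr0 divr1 subSS subn0 mulr1 mul1r.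
rewrite (dcoef_three1 gQ) [X in _ + (_ + X) = _](_ : _ =
    \sum_(i < j.+1) (dcoef (q * Q) i.+2 * scoef (Q / q ^+ i.+1) (j - i) +
      (three_term_a Q * (dcoef Q i.+1 * scoef (Q / q ^+ i.+1) (j - i)) +
       three_term_b Q * (dcoef (Q / q) i * scoef (Q / q ^+ i.+1) (j - i))))).
  by rewrite !big_split /= -!mulr_sumr; ring.
apply: eq_bigr => i _; rewrite /bump dcoef_three // !subSS.
by ring.
Qed.

Lemma pcoef_rec1 Q : generic Q ->
  (1 - q) * (1 - c * Q ^+ 2 / q ^+ 2) * pcoef Q 1 = (c + a * b) * Q / q - (a + b).
Proof.
move=> gQ; rewrite pcoef1 //; case: gQ => Q0 h.
have := h 2 0%N; rewrite expr0 mulr1 => h1; field.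
by rewrite q0 q1 h1.
Qed.

(* The terms of the left-hand side minus the right-hand side are the successive
   differences of [G]. *)
Lemma pcoef_rec Q j : generic Q ->
  (1 - q ^+ j.+2) * (1 - c * Q ^+ 2 / q ^+ j.+3) * pcoef Q j.+2 =
  ((c + a * b) * Q / q - (a + b) * q ^+ j.+1) * pcoef Q j.+1 + a * b * q ^+ j * pcoef Q j.
Proof.
move=> gQ; have [Q0 h] := gQ.
pose G i := (1 - q ^+ i) * (1 - c * Q ^+ 2 / q ^+ i.+1) * dcoef Q i
            * scoef (Q / q ^+ i) (j.+2 - i).
have tele : \sum_(i < j.+1) (G i - G i.+1) = - G j.+1.
  rewrite -(big_mkord xpredT (fun i => G i - G i.+1)).
  under eq_bigr do rewrite -opprB.
  rewrite sumrN telescope_sumr // /G expr0 subrr !mul0r subr0.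
  by [].
set L := (1 - q ^+ j.+2) * _; set M1 := _ - _; set M2 := a * b * _.
have key : \sum_(i < j.+1) (G i - G i.+1) =
    L * (\sum_(i < j.+1) dcoef Q i * scoef (Q / q ^+ i) (j.+2 - i))
    - (M1 * (\sum_(i < j.+1) dcoef Q i * scoef (Q / q ^+ i) (j.+1 - i)) +
       M2 * (\sum_(i < j.+1) dcoef Q i * scoef (Q / q ^+ i) (j - i))).
  rewrite !mulr_sumr -big_split -sumrB /=; apply: eq_bigr => -[i ij] _ /=.
  rewrite ltnS in ij; pose l := (j - i)%N.
  have e1 : (j.+1 - i)%N = l.+1 by rewrite subSn.
  have e2 : (j.+2 - i)%N = l.+2 by rewrite subSn ?e1 // leqW.
  have ej : q ^+ j = q ^+ l * q ^+ i by rewrite -exprD subnK.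
  rewrite /G /L /M1 /M2 e1 e2 subSS e1 -/l.
  have -> : Q / q ^+ i.+1 = (Q / q ^+ i) / q.
    by rewrite exprSr; field; rewrite q0 expf_neq0.
  rewrite scoefM; last by rewrite mulf_neq0 ?invr_neq0 ?expf_neq0.
  have := hq i; have := hq l; have := hq l.+1.
  have := h i.+2 0%N; rewrite /= !(exprSr q) ej !expr0 !mulr1.
  have := expf_neq0 i q0; have := expf_neq0 l q0.
  set x := q ^+ i; set y := q ^+ l => y0 x0 h3 h4 h5 h6; field.
  by rewrite q0 Q0 x0 y0 h3 h4 h5 h6.
move: key; rewrite tele => /eqP; rewrite eq_sym subr_eq => /eqP key.
rewrite {3}/pcoef [pcoef Q j.+2]big_ord_recr [X in L * (X + _)]big_ord_recr /=.
rewrite [pcoef Q j.+1]big_ord_recr /= !subnn subSnn !mulr1 !(mulrDr L) !(mulrDr M1) key.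
rewrite /G subSnn /L /M1 /=.
have := hq j; have := hq j.+1; have := h j.+2 0%N; have := h j.+3 0%N.
rewrite /= !(exprSr q) !expr0 !mulr1 ?mul1r; have := expf_neq0 j q0.
set z := q ^+ j => z0 h1 h2 h3 h4; field.
by rewrite q0 Q0 z0 h1 h2 h3 h4.
Qed.

End OneRow.

(** * Closed forms of the two coefficient families *)

Section ClosedForms.
Variables (F : fieldType) (q a b c : F).
Hypothesis q0 : q != 0.
Hypothesis hq : forall i, 1 - q ^+ i.+1 != 0.

Lemma qpochSl (z : F) n : qpoch z q n.+1 = (1 - z) * qpoch (z * q) q n.
Proof.
rewrite /qpoch big_ord_recl expr0 mulr1; congr (_ * _).
by apply: eq_bigr => i _; rewrite exprS mulrA.
Qed.

Lemma qpochSr (z : F) n : qpoch z q n.+1 = qpoch z q n * (1 - z * q ^+ n).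
Proof. by rewrite /qpoch big_ord_recr. Qed.

Lemma dcoefE Q i : generic q c Q -> dcoef q a b c Q i =
  qpoch (a * (Q / q ^+ i)) q i * qpoch (b * (Q / q ^+ i)) q i
  / ((Q / q ^+ i) ^+ i * qpoch (c * Q ^+ 2 / q ^+ i.+1) q i * qpoch q q i).
Proof.
move=> [Q0 h]; elim: i => [|i IH].
  by rewrite /qpoch !big_ord0 expr0 !mulr1 divr1.
have eM x p : x / q ^+ p.+1 * q = x / q ^+ p.
  by rewrite exprSr; field; rewrite q0 expf_neq0.
rewrite [LHS]/= IH !(qpochSl (_ / q ^+ _)) !(qpochSl (_ * _)) -!(mulrA _ (Q / _)) !eM.
rewrite (qpochSr q i) -exprS.
have -> : (Q / q ^+ i.+1) ^+ i.+1 = (Q / q ^+ i) ^+ i * (Q / (q ^+ i * q ^+ i.+1)).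
  rewrite exprSr {1}(_ : Q / q ^+ i.+1 = Q / q ^+ i / q) ?(expr_div_n _ q).
    by set w := (_ / _) ^+ i; field; rewrite !expf_neq0.
  by rewrite exprSr; field; rewrite q0 expf_neq0.
have := h i.+2 0%N; have := hq i; rewrite !(exprSr q) !expr0 !mulr1.
have := expf_neq0 i q0; set z := q ^+ i => z0 h1 h2.
set x := qpoch (c * _ / _) q i; set y := qpoch q q i; set w := _ ^+ i.
have x0 : x != 0.
  apply/prodf_neq0 => k _; have := h i.+1 k; apply: contra_neq => e.
  have -> : q ^+ i.+1 - c * Q ^+ 2 * q ^+ k = z * q * (1 - c * Q ^+ 2 / (z * q) * q ^+ k).
    by rewrite (exprSr q) -/z; field; rewrite q0 z0.
  by rewrite e mulr0.
have y0 : y != 0 by apply/prodf_neq0 => k _; rewrite -exprS.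
have w0 : w != 0 by rewrite !expf_neq0 ?mulf_neq0 ?invr_neq0.
field.
by rewrite q0 Q0 z0 h1 h2 x0 y0 w0.
Qed.

Lemma scoefE m l : (l <= m)%N -> scoef q (q ^+ m) l =
  (-1) ^+ l * q ^+ 'C(m - l, 2) / (q ^+ 'C(m, 2) * qpoch q q l).
Proof.
elim: l => [|l IH] lm.
  by rewrite subn0 /qpoch big_ord0 mulr1 expr0 mul1r divff ?expf_neq0.
rewrite /= IH ?(ltnW lm) // qpochSr -exprS -(subnSK lm) binS bin1 exprD.
have -> : q ^+ m = q ^+ (m - l.+1) * q ^+ l.+1 by rewrite -exprD subnK.
have := hq l; have := expf_neq0 (m - l.+1) q0; have := expf_neq0 l.+1 q0.
set x := q ^+ l.+1; set y := q ^+ (m - l.+1) => x0 y0 h.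
rewrite !invfM exprSr; set w := (qpoch _ _ _)^-1.
have := expf_neq0 'C(m, 2) q0; set v := q ^+ 'C(m, 2) => v0; field.
by rewrite v0 x0 y0 h.
Qed.

End ClosedForms.

Lemma det_mx22 (K : comPzRingType) (M : 'M[K]_2) :
  \det M = M ord0 ord0 * M ord_max ord_max - M ord0 ord_max * M ord_max ord0.
Proof.
rewrite (expand_det_row _ ord0) big_ord_recl big_ord1 /cofactor !det_mx11 !mxE /=.
rewrite expr0 expr1 mul1r mulN1r mulrN.
by congr (_ * M _ _ - M _ _ * M _ _); apply: val_inj.
Qed.

(** * Expansions of the row and hook functions *)

Section PhiRows.
Variables (R : realType) (q alpha beta : R) (gamma delta : R[i]).

Local Notation Q := (q%:C%C : R[i]).
Local Notation ca := (gamma / (alpha%:C%C : R[i]) * Q).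
Local Notation cb := (gamma / (beta%:C%C : R[i]) * Q).
Local Notation cc := (gamma * delta / ((alpha%:C%C : R[i]) * (beta%:C%C : R[i])) * Q ^+ 2).
Local Notation dc := (dcoef Q ca cb cc).
Local Notation pc := (pcoef Q ca cb cc).
Local Notation sc := (scoef Q).

Hypothesis hq : 0 < q < 1.
Hypothesis gamma0 : gamma != 0.
Hypothesis gen : forall n, generic Q cc (Q ^+ n).

Let q0 : Q != 0.
Proof. by case/andP: hq => q0 _; rewrite fmorph_eq0 gt_eqF. Qed.

Let hq1 i : 1 - Q ^+ i.+1 != 0.
Proof.
case/andP: hq => qp q1; rewrite -rmorphXn -(rmorph1 (real_complex R)) -rmorphB fmorph_eq0 subr_eq0.
by rewrite gt_eqF // exprn_ilt1 // ltW.
Qed.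

Lemma rho_entry11 la mu : (part mu 0 <= part la 0)%N ->
  rho_entry q alpha beta gamma delta la mu 1 1 =
  dc (Q ^+ part la 0) (part la 0 - part mu 0).
Proof.
rewrite /rho_entry -[1.-1]/0%N; move: (part la 0) (part mu 0) => n m mn.
rewrite dcoefE //.
have -> : n%:Z - m%:Z - 1 + 1 = (n - m)%N :> int by rewrite subrK subzn.
have -> : m%:Z - 1 + 2 = m.+1 :> int by lia.
have -> : (m%:Z - 1 + 1) * (n - m)%N = (m * (n - m))%N :> int by lia.
have -> : n%:Z + m%:Z - 1 - 1 + 3 = (n + m).+1 :> int by lia.
rewrite -!exprnP.
have -> : Q ^+ n / Q ^+ (n - m) = Q ^+ m.
  by rewrite -{1}(subnK mn) exprD mulrC mulKf ?expf_neq0.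
rewrite -exprM.
have -> : cc * (Q ^+ n) ^+ 2 / Q ^+ (n - m).+1 =
    gamma * delta / (alpha%:C%C * beta%:C%C) * Q ^+ (n + m).+1.
  set w := gamma * delta / _; rewrite -{1 3}(subnK mn) !exprSr !exprD; field.
  by rewrite q0 !expf_neq0.
by rewrite !exprS !mulrA.
Qed.

Lemma rho_row n m : (m <= n)%N ->
  rho q alpha beta gamma delta (row_part n) (row_part m) =
  (-1) ^+ (n - m) * gamma ^- n * dc (Q ^+ n) (n - m).
Proof.
move=> mn; rewrite /rho.
have sumr k : sumn (row_part k) = k by case: k => //= k; rewrite addn0.
rewrite !sumr subzn // -exprnP; congr (_ * _).
case: n mn => [|n] mn.
  by move: mn; rewrite leqn0 => /eqP ->; rewrite det_mx00.
by rewrite det_mx11 mxE rho_entry11 //; case: m mn.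
Qed.

Lemma nstat_row n : nstat (row_part n) = 0%N.
Proof. by case: n => [|n]; rewrite /nstat ?big_ord0 // big_ord1. Qed.

Lemma nstat_column m k : nstat (m :: nseq k 1%N) = 'C(k.+1, 2).
Proof.
rewrite -bin2_sum big_mkord /nstat /= size_nseq !big_ord_recl /= mul0n.
congr (_ + _)%N; apply: eq_bigr => -[i ik] _ /=.
by rewrite /part /= nth_nseq ik muln1.
Qed.

Lemma nstat_transpose_row n : nstat (transpose (row_part n)) = 'C(n, 2).
Proof.
case: n => [|n]; first by rewrite /nstat big_ord0.
rewrite -(nstat_column 1); congr nstat; rewrite /transpose /=; congr (_ :: _).
rewrite -[n in RHS](size_iota 1) -(size_map (fun j => (j < n.+1) + 0)%N).
apply/all_pred1P/allP => x /mapP[j]; rewrite mem_iota add1n => /andP[_ jn] ->.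
by rewrite /= jn.
Qed.

Lemma nstat_transpose_hook n : nstat (transpose [:: n.+1; 1%N]) = 'C(n.+1, 2).
Proof.
rewrite -(nstat_column 2); congr nstat; rewrite /transpose /=; congr (_ :: _).
rewrite -[n in RHS](size_iota 1) -(size_map (fun j => (j < n.+1) + ((j < 1) + 0))%N).
apply/all_pred1P/allP => x /mapP[j]; rewrite mem_iota add1n => /andP[j0 jn] ->.
by rewrite /= jn ltnNge j0.
Qed.

Lemma sigma_entry11 mu nu : (part nu 0 <= part mu 0)%N ->
  sigma_entry q mu nu 1 1 = (qpoch Q Q (part mu 0 - part nu 0))^-1.
Proof.
rewrite /sigma_entry -[1.-1]/0%N; move: (part nu 0) (part mu 0) => n m mn.
by rewrite subrK subzn.
Qed.

Lemma sigma_sign_power m k : (k <= m)%N ->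
  (-1) ^+ (m - k) * (Q ^+ 'C(k, 2) / Q ^+ 'C(m, 2)) * (qpoch Q Q (m - k))^-1 =
  sc (Q ^+ m) (m - k).
Proof.
by move=> km; rewrite scoefE ?leq_subr // subKn // invfM !mulrA.
Qed.

Lemma sigma_row m k : (k <= m)%N ->
  sigma q (row_part m) (row_part k) = sc (Q ^+ m) (m - k).
Proof.
move=> km; rewrite /sigma.
have sumr p : sumn (row_part p) = p by case: p => //= p; rewrite addn0.
rewrite !sumr subzn // -exprnP !nstat_row !nstat_transpose_row -sigma_sign_power //.
congr (_ * _ * _).
  by rewrite subr0 add0r addrC expfzDr // -exprnP exprnN.
case: m km => [|m] km.
  by move: km; rewrite leqn0 => /eqP ->; rewrite det_mx00 subnn /qpoch big_ord0 invr1.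
by rewrite det_mx11 mxE sigma_entry11 //; case: k km.
Qed.

(** The index r is negative in the lower left entry and 0 in the last one, so the determinant is
    triangular and reduces to the coefficient of a row. *)
Lemma rho_hook_hook n m : (m <= n)%N ->
  rho q alpha beta gamma delta [:: n.+1; 1%N] [:: m.+1; 1%N] =
  (-1) ^+ (n - m) * gamma ^- n.+2 * dc (Q ^+ n.+1) (n - m).
Proof.
move=> mn; rewrite /rho /= !addn0 !addn1.
rewrite subzn // -exprnP subSS; congr (_ * _).
rewrite det_mx22 !mxE /= rho_entry11 //= subSS.
rewrite [rho_entry _ _ _ _ _ _ _ 2 1](_ : _ = 0) ?mulr0 ?subr0; last first.
  rewrite /rho_entry /part /= (_ : _ - _ - _ + _ = Negz m) //.
  by rewrite NegzE; lia.
rewrite [rho_entry _ _ _ _ _ _ _ 2 2](_ : _ = 1) ?mulr1 //.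
by rewrite /rho_entry /part /= mulr0 expr0z /qpoch !big_ord0 !mulr1 divr1.
Qed.

(** Triangular again. The last entry sees the default part 0 in the second row of mu, so r = 1
    there, and the entry is the row coefficient at q^0 = 1. *)
Lemma rho_hook_row n m : (m <= n)%N ->
  rho q alpha beta gamma delta [:: n.+1; 1%N] [:: m.+1] =
  (-1) ^+ (n.+1 - m) * gamma ^- n.+2 * (dc (Q ^+ n.+1) (n - m) * dc 1 1).
Proof.
move=> mn; rewrite /rho /= !addn0 !addn1.
rewrite (subzn (leqW mn : (m.+1 <= n.+2)%N)) -exprnP subSS; congr (_ * _).
rewrite det_mx22 !mxE /= rho_entry11 //= subSS.
rewrite [rho_entry _ _ _ _ _ _ _ 2 1](_ : _ = 0) ?mulr0 ?subr0; last first.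
  rewrite /rho_entry /part /= (_ : _ - _ - _ + _ = Negz m) //.
  by rewrite NegzE; lia.
congr (_ * _).
rewrite /rho_entry /part /=.
rewrite mulr1 !expr0z /qpoch !big_ord1 !expr0 !expr1 !mulr1.
have [_ /(_ 2 0%N)] := gen 0; have := hq1 0.
rewrite (_ : Q ^ (0 - 2 + 1) = Q^-1) // !expr0 expr1 !expr1n !mulr1.
set u := gamma / _; set v := gamma / _; set w := _ / _ => h1 h2.
have h3 : 1 - w != 0.
  by apply: contra_neq h2 => e; rewrite -[X in X - _]mul1r -mulrBl e mul0r.
by field; rewrite q0 h1 h3.
Qed.

Lemma sigma_entry21 mu0 mu1 nu0 nu : (mu1 <= nu0)%N ->
  sigma_entry q [:: mu0; mu1] (nu0 :: nu) 2 1 = 0.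
Proof.
move=> h; rewrite /sigma_entry -[part _ _]/mu1 -[part _ (1.-1)]/nu0.
have -> : mu1%:Z - nu0%:Z - 2 + 1 = Negz (nu0 - mu1) by rewrite NegzE; lia.
by [].
Qed.

Lemma sigma_hook_hook m k : (k <= m)%N ->
  sigma q [:: m.+1; 1%N] [:: k.+1; 1%N] = sc (Q ^+ m.+1) (m - k).
Proof.
move=> km; rewrite /sigma /= !addn0 !addn1 subzn // -exprnP subSS.
rewrite !nstat_transpose_hook -(@sigma_sign_power m.+1 k.+1) // subSS.
congr (_ * _ * _).
  rewrite /nstat !big_ord_recl !big_ord0 /=.
  rewrite (_ : _ - _ - _ + _ = 'C(k.+1, 2)%:Z + - 'C(m.+1, 2)%:Z); last by lia.
  by rewrite expfzDr // -exprnP exprnN.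
rewrite det_mx22 !mxE /= sigma_entry21 // mulr0 subr0 sigma_entry11 //= subSS.
by rewrite /sigma_entry /= /qpoch big_ord0 invr1 mulr1.
Qed.

(** The last entry 1 / (1 - q), one more sign, and the factor q due to n((m+1, 1)) = 1 combine into
    -q / (1 - q), which is [scoef] at W = 1 and l = 1. *)
Lemma sigma_hook_row m k : (k <= m)%N ->
  sigma q [:: m.+1; 1%N] [:: k.+1] = sc (Q ^+ m.+1) (m - k) * sc 1 1.
Proof.
move=> km; rewrite /sigma /= !addn0 !addn1.
rewrite (subzn (leqW km : (k.+1 <= m.+2)%N)) -exprnP subSS subSn //.
rewrite nstat_transpose_hook -[[:: k.+1]]/(row_part k.+1) nstat_row nstat_transpose_row.
rewrite -(@sigma_sign_power m.+1 k.+1) // subSS.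
rewrite /nstat !big_ord_recl !big_ord0 /=.
rewrite (_ : _ - _ - _ + _ = 1%N%:Z + ('C(k.+1, 2)%:Z + - 'C(m.+1, 2)%:Z)); last by rewrite /bump /=; lia.
rewrite !expfzDr // -!exprnP exprnN.
rewrite det_mx22 !mxE /= sigma_entry21 // mulr0 subr0 sigma_entry11 //= subSS.
rewrite /sigma_entry /= /qpoch big_ord1 expr0 !mulr1 !expr1 exprS.
have := hq1 0; rewrite expr1 => h.
set x := (\prod_(i < _) _)^-1; set y := Q ^ _; set z := (-1) ^+ _.
by field.
Qed.

Lemma is_row n : is_intpart (row_part n).
Proof. by case: n => [|n]; rewrite // is_intpart_cons. Qed.

Lemma is_hook n : is_intpart [:: n.+1; 1%N].
Proof. by rewrite !is_intpart_cons. Qed.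

Lemma included_row k m : included (row_part k) (row_part m) = (k <= m)%N.
Proof.
case: k => [|k]; first by rewrite included_nil.
case: m => [|m]; last by rewrite included_cons included_nil andbT.
by apply/negbTE/forallP => /(_ ord0).
Qed.

Lemma subparts_row n : subparts (row_part n) = [seq row_part k | k <- iota 0 n.+1].
Proof.
case: n => [//|n].
rewrite -[LHS]/([::] :: [seq i.+1 :: nu | i <- iota 0 (minn n.+1 n.+1), nu <- [:: [::]]]).
rewrite minnn -[iota 0 n.+2]/(0%N :: iota (1 + 0) n.+1) iotaDl.
by elim: (iota 0 _) => //= i s [->].
Qed.

Lemma subparts_hook n : subparts [:: n.+1; 1%N] =
  [::] :: [seq k.+1 :: nu | k <- iota 0 n.+1, nu <- [:: [::]; [:: 1%N]]].
Proof.
rewrite -[LHS]/([::] :: [seq i.+1 :: nu | i <- iota 0 (minn n.+1 n.+1),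
                                          nu <- subparts_le i.+1 [:: 1%N]]).
have e i : subparts_le i.+1 [:: 1%N] = [:: [::]; [:: 1%N]] by case: i.
by rewrite minnn; congr (_ :: flatten _); apply: eq_map => i; rewrite e.
Qed.

Lemma sum_dcoef_scoef n k : (k <= n)%N ->
  \sum_(0 <= m < n.+1 | (k <= m)%N) dc (Q ^+ n) (n - m) * sc (Q ^+ m) (m - k) =
  pc (Q ^+ n) (n - k).
Proof.
move=> kn; rewrite big_nat_rev /= add0n /pcoef.
rewrite -(big_mkord xpredT (fun i => dc (Q ^+ n) i * sc (Q ^+ n / Q ^+ i) (n - k - i))).
rewrite [RHS](big_nat_widen _ _ n.+1) ?ltnS ?leq_subr //=.
apply: congr_big_nat => // i ni; first case/andP: ni => _ ni.
  by rewrite subSS; lia.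
case/and3P: ni => ki _; rewrite ltnS => ni; rewrite subSS in ki *.
have -> : Q ^+ n / Q ^+ i = Q ^+ (n - i).
  by rewrite -{1}(subnK ni) exprD mulfK ?expf_neq0.
by rewrite subKn // subnAC.
Qed.

Local Notation h := (complete_at q alpha beta).

Lemma sumn_row p : sumn (row_part p) = p.
Proof. by case: p => //= p; rewrite addn0. Qed.

Lemma Phi_row n X :
  Phi q alpha beta gamma delta (Sub (row_part n) (is_row n)) X =
  \sum_(0 <= k < n.+1) gamma ^+ k / gamma ^+ n * pc (Q ^+ n) (n - k) * (h X k)%:C%C.
Proof.
rewrite /Phi SubK subparts_row big_map -[iota 0 n.+1]/(index_iota 0 n.+1).
apply: eq_big_nat => k /andP[_ kn]; rewrite ltnS in kn.
rewrite schur_at_row //; congr (_ * _).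
rewrite big_map -sum_dcoef_scoef // mulr_sumr.
apply: congr_big_nat => // m hm; first by rewrite included_row.
case/and3P: hm; rewrite included_row => km _; rewrite ltnS => mn.
rewrite rho_row // sigma_row // !sumn_row subzn // -exprnP.
by rewrite -!(mulrA (_ ^+ (n - m))) signrMK; ring.
Qed.

(** Here the sign depends on m and no gamma^k appears, so the two sums do not merge into [pcoef].
    The inner sum is kept apart because it does not involve n. *)
Lemma Phi_printed_row n X :
  Phi_printed q alpha beta gamma delta (Sub (row_part n) (is_row n)) X =
  gamma ^- n * \sum_(0 <= m < n.+1) (-1) ^+ (n - m) * dc (Q ^+ n) (n - m) *
    \sum_(0 <= k < m.+1) sc (Q ^+ m) (m - k) * (h X k)%:C%C.
Proof.
rewrite /Phi_printed SubK subparts_row big_map -[iota 0 n.+1]/(index_iota 0 n.+1).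
transitivity (\sum_(0 <= k < n.+1) \sum_(0 <= m < n.+1 | (k <= m)%N)
    gamma ^- n * ((-1) ^+ (n - m) * dc (Q ^+ n) (n - m)
                  * (sc (Q ^+ m) (m - k) * (h X k)%:C%C))).
  apply: eq_big_nat => k /andP[_ kn]; rewrite ltnS in kn.
  rewrite schur_at_row // big_map mulr_suml.
  apply: congr_big_nat => // m hm; first by rewrite included_row.
  case/and3P: hm; rewrite included_row => km _; rewrite ltnS => mn.
  by rewrite rho_row // sigma_row //; ring.
under eq_bigr do rewrite -mulr_sumr.
rewrite -mulr_sumr; congr (_ * _).
rewrite (exchange_big_dep_nat xpredT) //=.
apply: eq_big_nat => m /andP[_ mn]; rewrite -mulr_sumr; congr (_ * _).
by rewrite [RHS](big_nat_widen _ _ n.+1).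
Qed.

Lemma big_subparts_hook (V : nmodType) n (P : pred (seq nat)) (G : seq nat -> V) :
  \sum_(mu <- subparts [:: n.+1; 1%N] | P mu) G mu =
  (if P [::] then G [::] else 0) + \sum_(0 <= m < n.+1)
    ((if P [:: m.+1] then G [:: m.+1] else 0)
     + (if P [:: m.+1; 1%N] then G [:: m.+1; 1%N] else 0)).
Proof.
rewrite subparts_hook big_mkcond big_cons big_allpairs_dep; congr (_ + _).
by apply: eq_bigr => m _; rewrite !big_cons big_nil /= addr0.
Qed.

Lemma sum_dcoef_scoefS n k : (k <= n)%N ->
  \sum_(0 <= m < n.+1 | (k <= m)%N) dc (Q ^+ n.+1) (n - m) * sc (Q ^+ m.+1) (m - k) =
  pc (Q ^+ n.+1) (n - k).
Proof.
move=> kn; rewrite -subSS -sum_dcoef_scoef // [RHS]big_mkcond big_nat_recl //= add0r.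
by rewrite big_mkcond; apply: eq_bigr => m _; rewrite ltnS !subSS.
Qed.

Let pc1 : pc 1 1 = dc 1 1 + sc 1 1.
Proof. by rewrite /pcoef big_ord_recr big_ord1 /= expr0 divr1 mul1r mulr1 addrC. Qed.

(** The box of the second row is removed either between lambda and mu or between mu and nu. The two
    contributions are [dcoef] and [scoef] at 1, with sum [pcoef] at 1. *)
Lemma sum_hook_row n k : (k <= n)%N ->
  \sum_(mu <- subparts [:: n.+1; 1%N] | included [:: k.+1] mu)
    (-1) ^ ((sumn [:: n.+1; 1%N])%:Z - (sumn mu)%:Z)
      * rho q alpha beta gamma delta [:: n.+1; 1%N] mu
      * (gamma ^+ sumn [:: k.+1] * sigma q mu [:: k.+1]) =
  gamma ^+ k.+1 / gamma ^+ n.+2 * pc (Q ^+ n.+1) (n - k) * pc 1 1.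
Proof.
move=> kn; rewrite big_subparts_hook.
rewrite (_ : included _ [::] = false) ?add0r; last by apply/negbTE/forallP => /(_ ord0).
rewrite -sum_dcoef_scoefS // -mulrA mulr_suml mulr_sumr [RHS]big_mkcond.
apply: eq_big_nat => m /andP[_ mn]; rewrite ltnS in mn.
rewrite !included_cons !included_nil andbT ltnS; case: leqP => [km|_]; last by rewrite addr0.
rewrite rho_hook_row // rho_hook_hook // sigma_hook_row //.
rewrite (@sigma_row m.+1 k.+1) // pc1.
set d1 := dc 1 1; set s1 := sc 1 1; rewrite /= !addn0 !addn1.
rewrite (subzn (leqW mn : (m.+1 <= n.+2)%N)) subzn // -!exprnP !subSS.
by rewrite -!(mulrA (_ ^+ (_ - _))) !signrMK; ring.
Qed.

Lemma sum_hook_hook n k : (k <= n)%N ->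
  \sum_(mu <- subparts [:: n.+1; 1%N] | included [:: k.+1; 1%N] mu)
    (-1) ^ ((sumn [:: n.+1; 1%N])%:Z - (sumn mu)%:Z)
      * rho q alpha beta gamma delta [:: n.+1; 1%N] mu
      * (gamma ^+ sumn [:: k.+1; 1%N] * sigma q mu [:: k.+1; 1%N]) =
  gamma ^+ k.+2 / gamma ^+ n.+2 * pc (Q ^+ n.+1) (n - k).
Proof.
move=> kn; rewrite big_subparts_hook.
rewrite (_ : included _ [::] = false) ?add0r; last by apply/negbTE/forallP => /(_ ord0).
rewrite -sum_dcoef_scoefS // mulr_sumr [RHS]big_mkcond.
apply: eq_big_nat => m /andP[_ mn]; rewrite ltnS in mn.
rewrite (_ : included _ [:: m.+1] = false) ?add0r; last first.
  by apply/negbTE/forallP => /(_ ord_max).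
rewrite !included_cons included_nil leqnn !andbT ltnS; case: leqP => [km|_ //].
rewrite rho_hook_hook // sigma_hook_hook //= !addn0 !addn1.
rewrite subzn // -!exprnP !subSS.
by rewrite -!(mulrA (_ ^+ (_ - _))) !signrMK; ring.
Qed.

(** The constant K collects the term of the empty partition; its value does not matter, as constants
    are multiples of Phi_(0). *)
Lemma Phi_hook n : exists K : R[i], forall X,
  Phi q alpha beta gamma delta (Sub [:: n.+1; 1%N] (is_hook n)) X =
  K + \sum_(0 <= k < n.+1) gamma ^+ k.+1 / gamma ^+ n.+1 * pc (Q ^+ n.+1) (n - k) *
    ((schur_at q alpha beta [:: k.+1; 1%N] X)%:C%C + (gamma^-1 * pc 1 1) * (h X k.+1)%:C%C).
Proof.
eexists => X; rewrite /Phi SubK {1}big_subparts_hook.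
rewrite (@schur_at_row _ q alpha beta X 0) complete_at0 mulr1; congr (_ + _).
apply: eq_big_nat => k /andP[_ kn]; rewrite ltnS in kn.
rewrite sum_hook_row // sum_hook_hook // (@schur_at_row _ q alpha beta X k.+1) !exprS.
have := expf_neq0 n gamma0; have := expf_neq0 k gamma0 => h1 h2.
by field; rewrite gamma0 h2.
Qed.

End PhiRows.

(** * Real form of the one-row coefficients *)

Section Monic.
Variables (F : fieldType) (q u v s p : F).
Implicit Type Q : F.

Local Notation e1 := (u + v).
Local Notation e2 := (u * v).
Local Notation c := (p * (u * v)).

(* With u = q / alpha, v = q / beta, s = gamma + delta, p = gamma delta, this is
   the recursion [pcoef_rec] divided by powers of gamma, which makes the
   coefficients real. The second index may exceed n: the values beyond it are
   coefficients of h_k with k < 0. *)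
Fixpoint monic_pair Q j : F * F :=
  if j is j'.+1 then
    let: (x, y) := monic_pair Q j' in
    (y, ((e2 * s * (Q / q) - e1 * q ^+ j'.+1) * y + e2 * q ^+ j' * x)
        / ((1 - q ^+ j'.+2) * (1 - c * Q ^+ 2 / q ^+ j'.+3)))
  else (1, (e2 * s * (Q / q) - e1) / ((1 - q) * (1 - c * Q ^+ 2 / q ^+ 2))).

Definition monic_coef Q j := (monic_pair Q j).1.

Lemma monic_coef0 Q : monic_coef Q 0 = 1. Proof. by []. Qed.

Lemma monic_coef1 Q : monic_coef Q 1 =
  (e2 * s * (Q / q) - e1) / ((1 - q) * (1 - c * Q ^+ 2 / q ^+ 2)).
Proof. by []. Qed.

Lemma monic_coefSS Q j : monic_coef Q j.+2 =
  ((e2 * s * (Q / q) - e1 * q ^+ j.+1) * monic_coef Q j.+1 + e2 * q ^+ j * monic_coef Q j)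
  / ((1 - q ^+ j.+2) * (1 - c * Q ^+ 2 / q ^+ j.+3)).
Proof. by rewrite /monic_coef /=; case: (monic_pair Q j). Qed.

Definition monic_a Q := monic_coef Q 1 - monic_coef (q * Q) 1.

(** The product (1 - gamma u x)(1 - gamma v x)(1 - delta u x)(1 - delta v x), expanded in s = gamma
    + delta and p = gamma delta. *)
Definition monic_num (x : F) :=
  1 - e1 * s * x + (p * e1 ^+ 2 + e2 * (s ^+ 2 - 2 * p)) * x ^+ 2
  - p * s * e1 * e2 * x ^+ 3 + p ^+ 2 * e2 ^+ 2 * x ^+ 4.

Definition monic_b Q := c * e2 / q * (Q / q) ^+ 2 * monic_num (Q / q)
  / ((1 - c * (Q / q) ^+ 2 / q) * (1 - c * (Q / q) ^+ 2) ^+ 2 * (1 - c * (Q / q) ^+ 2 * q)).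

Variables (gamma delta : F).
Hypothesis q0 : q != 0.
Hypothesis hq : forall i, 1 - q ^+ i.+1 != 0.
Hypothesis gamma0 : gamma != 0.
Hypotheses (hs : gamma + delta = s) (hp : gamma * delta = p).

Local Notation pc := (pcoef q (gamma * u) (gamma * v) c).

(** Both sides obey the same two-step recursion in j, and its leading factor is nonzero by
    [generic]. *)
Lemma pcoef_monic Q j : generic q c Q -> pc Q j = gamma ^+ j * monic_coef Q j.
Proof.
move=> gQ; have [Q0 h] := gQ.
have hn k i : 1 - c * Q ^+ 2 / q ^+ k * q ^+ i != 0.
  have := h k i; apply: contra_neq => e.
  have -> : q ^+ k - c * Q ^+ 2 * q ^+ i = q ^+ k * (1 - c * Q ^+ 2 / q ^+ k * q ^+ i).
    by field; rewrite expf_neq0.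
  by rewrite e mulr0.
suff : pc Q j = gamma ^+ j * monic_coef Q j /\
       pc Q j.+1 = gamma ^+ j.+1 * monic_coef Q j.+1 by case.
elim: j => [|j [IH1 IH2]]; split=> //.
- by rewrite pcoef0 monic_coef0 expr0 mulr1.
- have := hn 2 0%N; rewrite expr0 mulr1 => hd.
  apply: (@mulfI _ ((1 - q) * (1 - c * Q ^+ 2 / q ^+ 2))).
    by rewrite mulf_neq0 // (hq 0).
  rewrite pcoef_rec1 // monic_coef1 [RHS]mulrCA [X in _ = _ * X]mulrC divfK.
    by rewrite -hs -hp; field.
  by rewrite mulf_neq0 // (hq 0).
- have := hn j.+3 0%N; rewrite expr0 mulr1 => hd.
  have hd' : (1 - q ^+ j.+2) * (1 - c * Q ^+ 2 / q ^+ j.+3) != 0 by rewrite mulf_neq0.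
  apply: (mulfI hd'); rewrite pcoef_rec // IH1 IH2 monic_coefSS.
  rewrite [RHS]mulrCA [X in _ = _ * X]mulrC divfK //.
  by rewrite -hs -hp !(exprS gamma); field.
Qed.

Lemma three_term_a_monic Q : generic q c Q ->
  three_term_a q (gamma * u) (gamma * v) c Q = gamma * monic_a Q.
Proof.
move=> gQ; have gQ' := genericM q0 gQ.
have e x : generic q c x -> gamma * monic_coef x 1 = pc x 1.
  by move=> gx; rewrite pcoef_monic // expr1.
rewrite /monic_a mulrBr !e // !pcoef1 // /three_term_a.
by rewrite [q * Q]mulrC mulfK.
Qed.

Lemma three_term_b_monic Q : three_term_b q (gamma * u) (gamma * v) c Q = gamma ^+ 2 * monic_b Q.
Proof.
rewrite /three_term_b /monic_b; set x := Q / q; set d := (_ * _ * _)^-1.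
by rewrite /monic_num -hs -hp; field.
Qed.

Lemma monic_three Q j : generic q c Q -> monic_coef Q j.+2 =
  monic_coef (q * Q) j.+2 + monic_a Q * monic_coef Q j.+1 + monic_b Q * monic_coef (Q / q) j.
Proof.
move=> gQ; apply: (mulfI (expf_neq0 j.+2 gamma0)).
rewrite -pcoef_monic // pcoef_three // three_term_a_monic // three_term_b_monic.
rewrite !pcoef_monic //; [|exact: genericV|exact: genericM].
by rewrite !exprS; ring.
Qed.

End Monic.

(** * Gaussian decay *)

Lemma sqrnS n : (n.+1 ^ 2 = (n * 2 + n ^ 2).+1)%N.
Proof. by rewrite -addn1 sqrnD muln1 exp1n; lia. Qed.

Section Superexp.
Variables (R : realType) (r : R).
Hypothesis hr : 0 < r < 1.
Implicit Types (T : nat -> R) (K B : R).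

(** Decay like r^(n^2) with room for every factor K^n. This room makes the notion stable under index
    shifts, which change r^(n^2) by an exponential factor. *)
Definition superexp T :=
  forall K, 1 <= K -> exists B, forall n, K ^+ n * `|T n| <= B * r ^+ (n ^ 2).

Let r0 : 0 < r. Proof. by case/andP: hr. Qed.
Let r1 : r < 1. Proof. by case/andP: hr. Qed.
Let rX n : 0 < r ^+ n. Proof. exact: exprn_gt0. Qed.
Let rX0 n : 0 <= r ^+ n. Proof. exact/ltW. Qed.

(** As r^(n^2) = (r^n)^n, the product is at most 1 once |K| r^n is. *)
Lemma exp_gaussian_le K : exists B, forall n, K ^+ n * r ^+ (n ^ 2) <= B.
Proof.
pose L := 1 + `|K|.
have L1 : 1 <= L by rewrite lerDl.
have KL : `|K| <= L by rewrite lerDr.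
have [m hm] : exists m, L * r ^+ m <= 1.
  have /cvgrPdist_le/(_ 1 ltr01)[m _ hm] : (fun m => L * r ^+ m) @ \oo --> 0.
    rewrite -[X in _ --> X](mulr0 L); apply: cvgM; first exact: cvg_cst.
    by apply: cvg_expr; rewrite gtr0_norm.
  exists m; have := hm m (leqnn m); rewrite sub0r normrN ger0_norm //.
  by rewrite mulr_ge0 // (le_trans _ L1).
exists (L ^+ m) => n; apply: le_trans (ler_norm _) _.
rewrite normrM normrX (ger0_norm (rX0 _)).
have L0 : 0 <= L by apply: le_trans L1.
apply: (@le_trans _ _ (L ^+ n * r ^+ (n ^ 2))).
  by rewrite ler_wpM2r // lerXn2r ?nnegrE.
have [nm|mn] := leqP n m.
  by rewrite -[leRHS]mulr1 ler_pM ?exprn_ge0 ?ler_weXn2l ?exprn_ile1 ?(ltW r0) ?(ltW r1).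
apply: (@le_trans _ _ 1); last exact: exprn_ege1.
rewrite -mulnn exprM -exprMn exprn_ile1 ?mulr_ge0 //.
apply: le_trans hm; rewrite ler_wpM2l // ler_wiXn2l ?(ltW r0) ?(ltW r1) //.
exact: ltnW.
Qed.

Lemma superexp_dom T T' A : superexp T ->
  (forall n, (0 < n)%N -> `|T' n| <= A * (`|T n.+1| + `|T n| + `|T n.-1|)) ->
  superexp T'.
Proof.
move=> hT hA K K1; have K0 : 0 < K by apply: lt_le_trans K1.
have irg1 : 1 <= r^-1 by rewrite invf_ge1 // ltW.
(* The term with index n - 1 is short of r^(2n-1) against the wanted r^(n^2); the factor r^-2 in L
   pays for it. *)
pose L := K / r ^+ 2.
have L1 : 1 <= L.
  rewrite /L -exprVn -[1]mulr1 ler_pM // exprn_ege1 //.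
have L0 : 0 < L by apply: lt_le_trans L1.
have KL : K <= L by rewrite /L ler_peMr ?(ltW K0) // -exprVn exprn_ege1.
have [B hB] := hT _ L1.
have B0 : 0 <= B.
  have := hB 0%N; rewrite !expr0 mul1r mulr1; exact: le_trans.
pose C := `|A| * (3 * (B + K * B / r)).
exists (`|T' 0%N| + C) => n.
have C0 : 0 <= C.
  by rewrite !mulr_ge0 // addr_ge0 // !mulr_ge0 // ?invr_ge0 ltW.
case: n => [|n].
  by rewrite !expr0 mul1r mulr1 lerDl.
have hn := hA n.+1 isT.
apply: (@le_trans _ _ (C * r ^+ (n.+1 ^ 2))); last by rewrite ler_wpM2r // lerDr.
have hK i : K ^+ i * `|T i| <= B * r ^+ (i ^ 2).
  apply: le_trans (hB i); rewrite ler_wpM2r // lerXn2r ?nnegrE ?(ltW K0) //.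
  exact: ltW.
have h1 : K ^+ n.+1 * `|T n.+2| <= B * r ^+ (n.+1 ^ 2).
  apply: (@le_trans _ _ (K ^+ n.+2 * `|T n.+2|)).
    by rewrite ler_wpM2r // ler_weXn2l.
  apply: le_trans (hK _) _; rewrite ler_wpM2l // ler_wiXn2l ?(ltW r0) ?(ltW r1) //.
  by rewrite leq_exp2r.
have h2 := hK n.+1.
have h3 : K ^+ n.+1 * `|T n| <= K * B / r * r ^+ (n.+1 ^ 2).
  have -> : K ^+ n.+1 * `|T n| = K * r ^+ (n * 2) * (L ^+ n * `|T n|).
    rewrite /L expr_div_n -exprM exprS mulnC; field.
    by rewrite expf_neq0 // gt_eqF.
  have -> : K * B / r * r ^+ (n.+1 ^ 2) = K * r ^+ (n * 2) * (B * r ^+ (n ^ 2)).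
    by rewrite sqrnS exprS exprD; field; rewrite gt_eqF.
  by rewrite ler_wpM2l // mulr_ge0 // ltW.
have hn' : `|T' n.+1| <= `|A| * (`|T n.+2| + `|T n.+1| + `|T n|).
  by apply: le_trans hn _; rewrite ler_wpM2r ?ler_norm // !addr_ge0.
apply: (@le_trans _ _ (`|A| * (K ^+ n.+1 * `|T n.+2| + K ^+ n.+1 * `|T n.+1| + K ^+ n.+1 * `|T n|))).
  rewrite -!mulrDr mulrCA ler_wpM2l ?exprn_ge0 // ltW //.
rewrite /C -mulrA ler_wpM2l //.
set Z := r ^+ (n.+1 ^ 2) in h1 h2 h3 *.
have p1 : 0 <= B * Z by rewrite mulr_ge0 ?rX0.
have p2 : 0 <= K * B / r * Z by rewrite !mulr_ge0 ?rX0 ?invr_ge0 // ltW.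
have -> : 3 * (B + K * B / r) * Z = 3 * (B * Z) + 3 * (K * B / r * Z) by ring.
move: h1 h2 h3 p1 p2; move: (K * B / r * Z) (B * Z) => x y.
move: (_ * `|T n.+2|) (_ * `|T n.+1|) (_ * `|T n|) => x1 x2 x3.
clear; lra.
Qed.

Lemma superexpD T T' : superexp T -> superexp T' -> superexp (fun n => T n + T' n).
Proof.
move=> h h' K K1; have [B hB] := h K K1; have [B' hB'] := h' K K1.
exists (B + B') => n; rewrite mulrDl.
apply: le_trans (lerD (hB n) (hB' n)); rewrite -mulrDr ler_wpM2l ?ler_normD //.
by rewrite exprn_ge0 // (le_trans _ K1).
Qed.

Lemma superexpZ a T : superexp T -> superexp (fun n => a * T n).
Proof.
move=> h K K1; have [B hB] := h K K1; exists (`|a| * B) => n.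
by rewrite normrM mulrCA -[leRHS]mulrA ler_wpM2l.
Qed.

(** With L = 2 K / r^(2m), superexponential decay absorbs K^n and the cross term r^(2mn) of the
    square, and still bounds 2^n by a constant. *)
Lemma not_superexp T C K m : superexp T -> 0 <= C -> 1 <= K ->
  (forall n, r ^+ ((n + m) ^ 2) <= C * K ^+ n * `|T n|) -> False.
Proof.
move=> hT C0 K1 h; have K0 : 0 < K by apply: lt_le_trans K1.
pose L := 2 * K / r ^+ (m * 2).
have L1 : 1 <= L.
  rewrite /L ler_pdivlMr // mul1r (@le_trans _ _ 1) ?exprn_ile1 ?ltW //.
  lra.
have [B hB] := hT _ L1.
have key n : 2 ^+ n * r ^+ (m ^ 2) <= C * B.
  have := h n; have := hB n.
  rewrite (_ : (n + m) ^ 2 = n ^ 2 + m * 2 * n + m ^ 2)%N; last by rewrite sqrnD; lia.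
  rewrite !exprD; set x := r ^+ (n ^ 2); set y := r ^+ (m * 2 * n); set z := r ^+ (m ^ 2).
  have xy0 : 0 < x * y by rewrite mulr_gt0 /x /y ?rX.
  have eL : 2 ^+ n * (C * K ^+ n * `|T n|) = C * (L ^+ n * `|T n|) * y.
    by rewrite /L expr_div_n -exprM exprMn -/y; field; rewrite gt_eqF /y ?rX.
  move=> h1 h2; rewrite -(ler_pM2r xy0).
  have -> : 2 ^+ n * z * (x * y) = 2 ^+ n * (x * y * z) by ring.
  apply: le_trans (ler_wpM2l (exprn_ge0 n (ler0n R 2)) h2) _.
  rewrite eL (_ : C * B * (x * y) = C * (B * x) * y); last by ring.
  by rewrite ler_wpM2r /y ?rX0 // ler_wpM2l.
have [n hn] : exists n, C * B / r ^+ (m ^ 2) < n%:R.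
  exists (Num.bound `|C * B / r ^+ (m ^ 2)|).
  exact: le_lt_trans (ler_norm _) (archi_boundP (normr_ge0 _)).
have := key n; rewrite -ler_pdivlMr // => /le_lt_trans/(_ hn).
by rewrite -natrX ltr_nat ltnNge ltnW // ltn_expl.
Qed.

End Superexp.

Lemma leq_expo1 n j N : (j <= n + N -> j.+3 <= n * 2 + (N + 3))%N.
Proof. lia. Qed.

Lemma leq_expo2 j : (4 * j + j ^ 2 <= j.+2 ^ 2)%N.
Proof. rewrite !sqrnS; lia. Qed.

Arguments hsym : simpl never.

(** * Lower bounds by backward recursion, and removal of points *)

Section MonicGrowth.
Variables (R : realType) (q u v s p : R).
Hypothesis hq : 0 < q < 1.
Hypothesis hc : p * (u * v) < 0.

Local Notation e1 := (u + v).
Local Notation e2 := (u * v).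
Local Notation c := (p * (u * v)).
Local Notation g n j := (monic_coef q u v s p (q ^+ n) j).
Local Notation ma := (monic_a q u v s p).
Local Notation mb := (monic_b q u v s p).

Let q0 : 0 < q. Proof. by case/andP: hq. Qed.
Let q1 : q < 1. Proof. by case/andP: hq. Qed.
Let qX n : 0 < q ^+ n. Proof. exact: exprn_gt0. Qed.
Let qX1 n : q ^+ n <= 1. Proof. by rewrite exprn_ile1 // ltW. Qed.
Let e20 : 0 < `|e2|.
Proof. by rewrite normr_gt0; apply: contraTneq hc => ->; rewrite mulr0 ltxx. Qed.

Let one_sub_qX n : 1 - q <= 1 - q ^+ n.+1.
Proof. by rewrite lerD2l lerN2 exprS ger_pMr. Qed.

(** This is where the sign of c acts: all denominators of the recursions are bounded below. *)
Lemma den_ge1 x : 0 <= x -> 1 <= 1 - c * x.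
Proof. by move=> x0; rewrite lerDl oppr_ge0 mulr_le0_ge0 // ltW. Qed.

Let sq_div_ge0 x n : 0 <= x ^+ 2 / q ^+ n.
Proof. by rewrite divr_ge0 ?sqr_ge0 // ltW. Qed.

Definition root4 := Num.sqrt (Num.sqrt q).
Local Notation r := root4.

Lemma root4X : r ^+ 4 = q.
Proof.
rewrite (exprM _ 2 2) /root4 sqr_sqrtr ?sqrtr_ge0 // sqr_sqrtr //.
exact: ltW.
Qed.

Lemma root4_bounds : 0 < r < 1.
Proof.
rewrite /root4 !sqrtr_gt0 q0 /=.
by rewrite -[ltRHS]sqrtr1 ltr_sqrt ?ltr01 // -[ltRHS]sqrtr1 ltr_sqrt ?ltr01.
Qed.

Let r0 : 0 < r. Proof. by case/andP: root4_bounds. Qed.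
Let r1 : r < 1. Proof. by case/andP: root4_bounds. Qed.
Let rX n : 0 < r ^+ n. Proof. exact: exprn_gt0. Qed.

Lemma monic_rec n j :
  e2 * q ^+ j * g n j =
  (1 - q ^+ j.+2) * (1 - c * ((q ^+ n) ^+ 2 / q ^+ j.+3)) * g n j.+2
  - (e2 * s * (q ^+ n / q) - e1 * q ^+ j.+1) * g n j.+1.
Proof.
rewrite monic_coefSS; set D := (1 - q ^+ j.+2) * _.
have D0 : D != 0.
  apply: mulf_neq0; rewrite gt_eqF //.
    by apply: lt_le_trans (one_sub_qX _); rewrite subr_gt0.
  by apply: lt_le_trans (den_ge1 (sq_div_ge0 _ _)).
by rewrite -(mulrA c) -/D; field; rewrite D0 gt_eqF.
Qed.

(* The weights r^(j^2), r^4 = q, absorb the factor q^j lost when two steps of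
   [monic_rec] are undone. *)
Lemma monic_back N : exists2 K, 1 <= K & forall n j, (j <= n + N)%N ->
  `|g n j| / r ^+ (j ^ 2) <=
  K * Num.max (`|g n j.+1| / r ^+ (j.+1 ^ 2)) (`|g n j.+2| / r ^+ (j.+2 ^ 2)).
Proof.
(* The range j <= n + N gives q^(2n) / q^(j+3) <= q^-(N+3), whence K1, and q^n <= q^j / q^N, whence
   a factor q^j in the middle coefficient. So only the term of index j + 2 meets the loss of q^j. *)
pose K1 := 1 + `|c| / q ^+ (N + 3).
pose K2 := `|e2 * s| / q ^+ (N + 1) + `|e1|.
have K10 : 0 <= K1 by rewrite addr_ge0 // divr_ge0 // ltW.
have K20 : 0 <= K2 by rewrite addr_ge0 // divr_ge0 // ltW.
exists (1 + (K1 + K2) / `|e2|).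
  by rewrite lerDl divr_ge0 // addr_ge0.
move=> n j jn; set M := Num.max _ _.
have M1 : `|g n j.+1| / r ^+ (j.+1 ^ 2) <= M by rewrite le_max lexx.
have M2 : `|g n j.+2| / r ^+ (j.+2 ^ 2) <= M by rewrite le_max lexx orbT.
have M0 : 0 <= M by apply: le_trans M1; rewrite divr_ge0 // ltW.
rewrite ler_pdivrMr //.
have qj : q ^+ n <= q ^+ j / q ^+ N.
  rewrite ler_pdivlMr // -exprD ler_wiXn2l ?(ltW q0) ?(ltW q1) //.
have hD : `|(1 - q ^+ j.+2) * (1 - c * ((q ^+ n) ^+ 2 / q ^+ j.+3))| <= K1.
  rewrite normrM -[leRHS]mul1r ler_pM //.
    by rewrite ger0_norm ?subr_ge0 // gerBl ltW.
  rewrite (le_trans (ler_normB _ _)) // normr1 /K1 lerD2l normrM ler_wpM2l //.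
  rewrite ger0_norm // ler_pdivrMr // mulrC ler_pdivlMr //.
  rewrite -exprM -exprD ler_wiXn2l ?(ltW q0) ?(ltW q1) //.
  exact: leq_expo1.
have hM : `|e2 * s * (q ^+ n / q) - e1 * q ^+ j.+1| <= K2 * q ^+ j.
  rewrite (le_trans (ler_normB _ _)) // /K2 [leRHS]mulrDl lerD //.
    rewrite normrM -[leRHS]mulrA ler_wpM2l // ger0_norm ?divr_ge0 ?(ltW q0) ?(ltW (qX _)) //.
    apply: (@le_trans _ _ (q ^+ j / q ^+ N / q)).
      by rewrite ler_pM2r ?invr_gt0.
    by rewrite addn1 exprSr invfM [leRHS]mulrC mulrA.
  rewrite normrM ler_wpM2l // ger0_norm ?(ltW (qX _)) // ler_wiXn2l ?(ltW q0) ?(ltW q1) //.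
have key : `|e2| * q ^+ j * `|g n j| <= K1 * `|g n j.+2| + K2 * q ^+ j * `|g n j.+1|.
  rewrite -{1}(ger0_norm (ltW (qX j))) -!normrM monic_rec.
  rewrite (le_trans (ler_normB _ _)) // !normrM lerD // ?ler_wpM2r //.
  by rewrite -normrM.
have b1 : `|g n j.+1| <= M * r ^+ (j ^ 2).
  apply: (@le_trans _ _ (M * r ^+ (j.+1 ^ 2))); first by rewrite -ler_pdivrMr.
  by rewrite ler_wpM2l // ler_wiXn2l ?(ltW r0) ?(ltW r1) // leq_exp2r.
have b2 : `|g n j.+2| <= M * (q ^+ j * r ^+ (j ^ 2)).
  apply: (@le_trans _ _ (M * r ^+ (j.+2 ^ 2))); first by rewrite -ler_pdivrMr.
  rewrite ler_wpM2l // -{1}root4X -exprM -exprD ler_wiXn2l ?(ltW r0) ?(ltW r1) //.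
  exact: leq_expo2.
have {}key : `|e2| * q ^+ j * `|g n j| <= `|e2| * q ^+ j * ((K1 + K2) / `|e2| * M * r ^+ (j ^ 2)).
  apply: (le_trans key).
  apply: (@le_trans _ _ (K1 * (M * (q ^+ j * r ^+ (j ^ 2))) + K2 * q ^+ j * (M * r ^+ (j ^ 2)))).
    by rewrite lerD // ler_wpM2l // mulr_ge0 // ltW.
  by rewrite le_eqVlt; apply/orP; left; apply/eqP; field; rewrite gt_eqF.
rewrite ler_pM2l ?mulr_gt0 // in key; apply: le_trans key _.
by rewrite ler_wpM2r ?(ltW (rX _)) // ler_wpM2r // lerDr.
Qed.

(** The recursion starts from the coefficient 1 at j = 0. By [monic_back] the weighted maximum over
    the window j, j+1 is at most K times that over the next window, so a maximum of at least
    K^-(n+N) is left after n + N steps. *)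
Lemma monic_lower N : exists2 K, 1 <= K & forall n,
  r ^+ ((n + N.+1) ^ 2) <= K ^+ (n + N) * (`|g n (n + N)| + `|g n (n + N.+1)|).
Proof.
have [K K1 hK] := monic_back N; exists K => // n.
pose W j := Num.max (`|g n j| / r ^+ (j ^ 2)) (`|g n j.+1| / r ^+ (j.+1 ^ 2)).
have W0 j : 0 <= W j by rewrite /W le_max divr_ge0 // ltW.
have hW j : (j <= n + N)%N -> 1 <= K ^+ j * W j.
  elim: j => [_|j IH jn].
    by rewrite expr0 mul1r /W le_max /= normr1 divr1 lexx.
  apply: le_trans (IH (ltnW jn)) _.
  rewrite exprSr -mulrA ler_wpM2l ?exprn_ge0 ?(le_trans _ K1) //.
  rewrite {1}/W ge_max hK ?(ltnW jn) //=.
  apply: (@le_trans _ _ (1 * W j.+1)); last by rewrite ler_wpM2r.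
  by rewrite mul1r /W le_max lexx.
have h1 := hW _ (leqnn (n + N)%N); rewrite addnS.
rewrite -(ler_pM2r (rX ((n + N).+1 ^ 2))) mul1r in h1; apply: le_trans h1 _.
rewrite -mulrA ler_wpM2l ?exprn_ge0 ?(le_trans _ K1) //.
rewrite -ler_pdivlMr // /W ge_max; apply/andP; split.
  apply: (@le_trans _ _ (`|g n (n + N)%N| / r ^+ ((n + N).+1 ^ 2))).
    rewrite ler_wpM2l // lef_pV2 ?posrE // ler_wiXn2l ?(ltW r0) ?(ltW r1) //.
    by rewrite leq_exp2r.
  by rewrite ler_pM2r ?invr_gt0 // lerDl.
by rewrite ler_pM2r ?invr_gt0 // lerDr.
Qed.

Lemma monic_not_superexp N : superexp r (fun n => g n (n + N)%N) ->
  superexp r (fun n => g n (n + N.+1)%N) -> False.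
Proof.
move=> h h'; have [K K1 hK] := monic_lower N.
have hT : superexp r (fun n => `|g n (n + N)%N| + `|g n (n + N.+1)%N|).
  have hn T : superexp r T -> superexp r (fun n => `|T n|).
    by move=> hT L L1; have [B hB] := hT L L1; exists B => n; rewrite normr_id.
  by apply: superexpD; exact: hn.
apply: (@not_superexp _ _ root4_bounds _ (K ^+ N) K N.+1 hT) => //.
  by rewrite exprn_ge0 // (le_trans _ K1).
move=> n; rewrite ger0_norm ?addr_ge0 //; apply: le_trans (hK n) _.
by rewrite exprD [K ^+ n * _]mulrC.
Qed.

Lemma monic_a_le : exists A, forall n, `|ma (q ^+ n.+1)| <= A.
Proof.
pose B := (`|e2 * s| + `|e1|) / (1 - q).
have hB n : `|monic_coef q u v s p (q ^+ n.+1) 1| <= B.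
  have d1 : 1 <= 1 - c * (q ^+ n.+1) ^+ 2 / q ^+ 2 by rewrite -mulrA den_ge1.
  have q1' : 0 < 1 - q by rewrite subr_gt0.
  have d0 : 0 < 1 - c * (q ^+ n.+1) ^+ 2 / q ^+ 2 by apply: lt_le_trans d1.
  rewrite monic_coef1 normrM ler_pM //.
    rewrite (le_trans (ler_normB _ _)) // lerD // exprSr mulfK ?gt_eqF // normrM.
    by rewrite ler_piMr // ger0_norm ?(ltW (qX _)).
  rewrite ger0_norm ?invr_ge0 ?mulr_ge0 ?(ltW q1') ?(ltW d0) //.
  by rewrite lef_pV2 ?posrE ?mulr_gt0 // ler_peMr // ltW.
exists (B + B) => n; apply: le_trans (ler_normB _ _) (lerD (hB _) _).
by rewrite -exprS.
Qed.

(** At Q = q^(n+1) the factor (Q / q)^2 is q^(2n) and the others are bounded; this is the source of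
    the Gaussian decay of the norms. *)
Lemma monic_b_le : exists2 B, 0 <= B & forall n, `|mb (q ^+ n.+1)| <= B * q ^+ (n * 2).
Proof.
(* The sum of the moduli of the coefficients of [monic_num], which bounds it on [0, 1]. *)
pose N := 1 + `|e1 * s| + `|p * e1 ^+ 2 + e2 * (s ^+ 2 - 2 * p)| + `|p * s * e1 * e2|
          + `|p ^+ 2 * e2 ^+ 2|.
have N0 : 0 <= N by rewrite !addr_ge0.
exists (`|c * e2 / q| * N) => [|n]; first by rewrite mulr_ge0.
have -> : mb (q ^+ n.+1) = mb (q ^+ n * q) by rewrite exprSr.
rewrite /monic_b mulfK ?gt_eqF // exprM.
set x := q ^+ n; have x0 : 0 <= x := ltW (qX n).
have x1 : x <= 1 := qX1 n.
have d1 : 1 <= 1 - c * x ^+ 2 / q.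
  by rewrite -mulrA den_ge1 // divr_ge0 ?sqr_ge0 // ltW.
have d2 : 1 <= 1 - c * x ^+ 2 by rewrite den_ge1 ?sqr_ge0.
have d3 : 1 <= 1 - c * x ^+ 2 * q.
  by rewrite -mulrA den_ge1 // mulr_ge0 ?sqr_ge0 // ltW.
set D := (_ * _ * _)^-1.
have D1 : `|D| <= 1.
  have h : 1 <= (1 - c * x ^+ 2 / q) * (1 - c * x ^+ 2) ^+ 2 * (1 - c * x ^+ 2 * q).
    by rewrite !mulr_ege1 // exprn_ege1.
  have h0 := lt_le_trans ltr01 h.
  by rewrite /D ger0_norm ?invr_ge0 ?(ltW h0) // invf_le1.
have hN : `|monic_num u v s p x| <= N.
  have hx a k : `|a * x ^+ k| <= `|a|.
    rewrite normrM ler_piMr // normrX (ger0_norm x0).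
    exact: exprn_ile1.
  rewrite /monic_num.
  apply: le_trans (ler_normD _ _) (lerD _ (hx _ _)).
  apply: le_trans (ler_normB _ _) (lerD _ (hx _ _)).
  apply: le_trans (ler_normD _ _) (lerD _ (hx _ _)).
  by apply: le_trans (ler_normB _ _) (lerD _ (hx _ 1%N)); rewrite normr1.
set A := c * e2 / q; rewrite (normrM _ D) (normrM _ (monic_num _ _ _ _ _)) (normrM A).
rewrite (ger0_norm (sqr_ge0 x)) -[leRHS]mulr1 ler_pM ?mulr_ge0 ?sqr_ge0 //.
by rewrite mulrAC ler_wpM2r ?sqr_ge0 // ler_wpM2l.
Qed.

(** With f the coefficients of Phi_(n) and w the values h_k(X), index n gives Phi_(n)(X). Index n +
    i replaces each h_k by h_(k+i) and brings in the formal coefficients of h_(-1), ..., h_(-i). *)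
Definition hconv (f w : nat -> R) m := \sum_(l < m.+1) f l * w (m - l)%N.

Lemma hconv_nil f m : hconv f (hsym [::]) m = f m.
Proof.
rewrite /hconv big_ord_recr /= subnn hsym0 mulr1 big1 ?add0r // => -[l lm] _ /=.
by rewrite /hsym subn_eq0 leqNgt lm mulr0.
Qed.

Lemma hconv_cons f x t m : hconv f (hsym (x :: t)) m.+1 =
  hconv f (hsym t) m.+1 + x * hconv f (hsym (x :: t)) m.
Proof.
rewrite /hconv big_ord_recr [in RHS]big_ord_recr /= !subnn !hsym0.
rewrite mulr_sumr addrAC -big_split; congr (_ + _); apply: eq_bigr => -[l lm] _ /=.
by rewrite subSn // hsym_cons; ring.
Qed.

Lemma hconv_three f f0 f1 a b w m : f 0%N = f1 0%N -> f 1%N = f1 1%N + a * f 0%N ->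
  (forall j, f j.+2 = f1 j.+2 + a * f j.+1 + b * f0 j) ->
  hconv f w m.+2 = hconv f1 w m.+2 + a * hconv f w m.+1 + b * hconv f0 w m.
Proof.
move=> f_0 f_1 f_2; rewrite /hconv.
have E (F : nat -> R) : \sum_(l < m.+3) F l * w (m.+2 - l)%N = F 0%N * w m.+2 +
    (F 1%N * w m.+1 + \sum_(l < m.+1) F l.+2 * w (m - l)%N).
  by rewrite 2!big_ord_recl.
have -> : \sum_(l < m.+2) f l * w (m.+1 - l)%N =
    f 0%N * w m.+1 + \sum_(l < m.+1) f l.+1 * w (m - l)%N.
  by rewrite big_ord_recl.
rewrite (E f) (E f1) f_0 f_1.
under eq_bigr do rewrite f_2 !mulrDl -!mulrA.
by rewrite !big_split /= -!mulr_sumr f_0; ring.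
Qed.

Hypothesis three : forall n j, g n.+1 j.+2 =
  g n.+2 j.+2 + ma (q ^+ n.+1) * g n.+1 j.+1 + mb (q ^+ n.+1) * g n j.

Lemma hconv_monic_three w n m : hconv (fun j => g n.+1 j) w m.+2 =
  hconv (fun j => g n.+2 j) w m.+2 + ma (q ^+ n.+1) * hconv (fun j => g n.+1 j) w m.+1
  + mb (q ^+ n.+1) * hconv (fun j => g n j) w m.
Proof.
apply: hconv_three => //.
by rewrite monic_coef0 mulr1 /monic_a -exprS addrC subrK.
Qed.

Lemma hconv_not_superexp t : superexp r (fun n => hconv (fun j => g n j) (hsym t) n) -> False.
Proof.
(* The relation expresses the value shifted by i + 1 through three neighbouring rows shifted by i,
   so decay spreads from i = 0 to all shifts. The vacuous bound 0 <= i becomes the threshold of the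
   next induction. *)
move=> h0; have {h0} : forall i, (0 <= i)%N ->
    superexp r (fun n => hconv (fun j => g n j) (hsym t) (n + i)).
  move=> + _; elim=> [|i IH].
    by move=> K K1; have [B hB] := h0 K K1; exists B => n; rewrite addn0.
  have [A hA] := monic_a_le; have [B B0 hB] := monic_b_le.
  apply: (superexp_dom root4_bounds (A := 1 + A + B) IH) => -[//|n] _ /=.
  have A0 : 0 <= A by apply: le_trans (hA 0%N).
  rewrite addSn addnS hconv_monic_three !addSn.
  set x := hconv _ _ _; set y := hconv _ _ (n + i).+1; set z := hconv _ _ (n + i).
  apply: (@le_trans _ _ (`|x| + A * `|y| + B * `|z|)).
    rewrite (le_trans (ler_normD _ _)) // lerD //.
      by rewrite (le_trans (ler_normD _ _)) // lerD // normrM ler_wpM2r.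
    rewrite normrM ler_wpM2r // (le_trans (hB n)) // ler_piMr //.
  rewrite !mulrDl !mulrDr.
  have := mulr_ge0 A0 (normr_ge0 x); have := mulr_ge0 A0 (normr_ge0 z).
  have := mulr_ge0 B0 (normr_ge0 x); have := mulr_ge0 B0 (normr_ge0 y).
  have := normr_ge0 x; have := normr_ge0 y; have := normr_ge0 z.
  lra.
(* Removing one point by [hconv_cons] uses decay at two consecutive shifts, so the threshold rises
   by one. Without points the convolution is the coefficient itself. *)
move: (0%N); elim: t => [|x t IH] i0 h.
  have h' i : (i0 <= i)%N -> superexp r (fun n => g n (n + i)%N).
    move=> ii K K1; have [B hB] := h i ii K K1.
    by exists B => n; rewrite -[g _ _](hconv_nil (fun j => g n j)).
  exact: monic_not_superexp (h' _ (leqnn i0)) (h' _ (leqnSn i0)).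
apply: (IH i0.+1) => -[//|i] ii K K1.
have hs := superexpD (h i.+1 (leqW ii)) (superexpZ (- x) (h i ii)).
have [B hB] := hs K K1; exists B => n; have := hB n.
by rewrite addnS hconv_cons mulNr addrK.
Qed.

End MonicGrowth.

(** * Orthogonality and the masses of finite configurations *)

Section InnerProduct.
Variables (R : realType) (d : measure_display) (T : measurableType d).
Variable M : probability T R.
Implicit Types f g : T -> R[i].

Lemma Lfun2_lin (f g : T -> R) a b : f \in Lfun M 2%:E -> g \in Lfun M 2%:E ->
  (fun x => a * f x + b * g x) \in Lfun M 2%:E.
Proof.
move=> hf hg; have h2 : (1 <= 2%:E :> \bar R)%E by rewrite lee1n.
have [h0 h] := Lfun_submod_closed M h2.
have := h a f (b *: g + 0) hf (h b g 0 hg h0).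
by rewrite addr0.
Qed.

Lemma inL2_lin f g a b : inL2 M f -> inL2 M g -> inL2 M (fun x => a * f x + b * g x).
Proof.
move=> [f1 f2] [g1 g2]; case: a => a1 a2; case: b => b1 b2; split.
  rewrite [X in X \in _](_ : _ = fun x =>
      1 * (a1 * complex.Re (f x) + - a2 * complex.Im (f x))
      + 1 * (b1 * complex.Re (g x) + - b2 * complex.Im (g x))).
    by do ![apply: Lfun2_lin => //].
  apply/funext => x /=; by case: (f x) => ? ?; case: (g x) => ? ? /=; ring.
rewrite [X in X \in _](_ : _ = fun x =>
    1 * (a2 * complex.Re (f x) + a1 * complex.Im (f x))
    + 1 * (b2 * complex.Re (g x) + b1 * complex.Im (g x))).
  by do ![apply: Lfun2_lin => //].
by apply/funext => x /=; case: (f x) => ? ?; case: (g x) => ? ? /=; ring.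
Qed.

Lemma inL2_0 : inL2 M (fun=> 0).
Proof. by split; exact: Lfun_cst. Qed.

Lemma Lfun2_mul_integrable (f g : T -> R) : f \in Lfun M 2%:E -> g \in Lfun M 2%:E ->
  M.-integrable setT (EFin \o (fun x => f x * g x)).
Proof. by move=> hf hg; apply/Lfun1_integrable; exact: Lfun2_mul_Lfun1. Qed.

Lemma integrable_lin (f g : T -> R) a b :
  M.-integrable setT (EFin \o f) -> M.-integrable setT (EFin \o g) ->
  M.-integrable setT (EFin \o (fun x => a * f x + b * g x)).
Proof.
move=> hf hg.
have -> : EFin \o (fun x => a * f x + b * g x) =
   (fun x => (a%:E * (EFin \o f) x) + (b%:E * (EFin \o g) x))%E by apply/funext.
by apply: integrableD => //; exact: integrableZl.
Qed.

Lemma Rintegral_lin (f g : T -> R) a b :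
  M.-integrable setT (EFin \o f) -> M.-integrable setT (EFin \o g) ->
  \int[M]_x (a * f x + b * g x) = a * (\int[M]_x f x) + b * (\int[M]_x g x).
Proof.
move=> hf hg.
have hZ r (k : T -> R) : M.-integrable setT (EFin \o k) ->
    M.-integrable setT (EFin \o (fun x => r * k x)).
  by move=> hk; have := integrableZl measurableT r hk.
by rewrite RintegralD ?RintegralZl //; exact: hZ.
Qed.

Lemma inner_integrable f g : inL2 M f -> inL2 M g ->
  M.-integrable setT (EFin \o (fun x => complex.Re (f x * (g x)^*%C))) /\
  M.-integrable setT (EFin \o (fun x => complex.Im (f x * (g x)^*%C))).
Proof.
move=> [f1 f2] [g1 g2]; split.
  rewrite [X in integrable _ _ X](_ : _ = EFin \o (fun x =>
      1 * (complex.Re (f x) * complex.Re (g x)) + 1 * (complex.Im (f x) * complex.Im (g x)))).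
    by apply: integrable_lin; exact: Lfun2_mul_integrable.
  apply/funext => x /=; congr EFin.
  by case: (f x) => ? ?; case: (g x) => ? ? /=; ring.
rewrite [X in integrable _ _ X](_ : _ = EFin \o (fun x =>
    1 * (complex.Im (f x) * complex.Re (g x)) + -1 * (complex.Re (f x) * complex.Im (g x)))).
  by apply: integrable_lin; exact: Lfun2_mul_integrable.
apply/funext => x /=; congr EFin.
by case: (f x) => ? ?; case: (g x) => ? ? /=; ring.
Qed.

Lemma inner_lin f1 f2 g a b : inL2 M f1 -> inL2 M f2 -> inL2 M g ->
  inner M (fun x => a * f1 x + b * f2 x) g = a * inner M f1 g + b * inner M f2 g.
Proof.
move=> h1 h2 hg; have [r1 i1] := inner_integrable h1 hg.
have [r2 i2] := inner_integrable h2 hg.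
rewrite /inner /cintegral; case: a => a1 a2; case: b => b1 b2.
rewrite [X in (X +i* _)%C](_ : _ = a1 * (\int[M]_x complex.Re (f1 x * (g x)^*%C))
    - a2 * (\int[M]_x complex.Im (f1 x * (g x)^*%C))
    + (b1 * (\int[M]_x complex.Re (f2 x * (g x)^*%C))
    - b2 * (\int[M]_x complex.Im (f2 x * (g x)^*%C)))); last first.
  rewrite -!mulNr -!Rintegral_lin //.
  have := Rintegral_lin 1 1 (integrable_lin a1 (- a2) r1 i1) (integrable_lin b1 (- b2) r2 i2).
  rewrite !mul1r => <-; apply: eq_Rintegral => x _ /=.
  by case: (f1 x) => ? ?; case: (f2 x) => ? ?; case: (g x) => ? ? /=; ring.
rewrite [X in (_ +i* X)%C = _](_ : _ = a2 * (\int[M]_x complex.Re (f1 x * (g x)^*%C))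
    + a1 * (\int[M]_x complex.Im (f1 x * (g x)^*%C))
    + (b2 * (\int[M]_x complex.Re (f2 x * (g x)^*%C))
    + b1 * (\int[M]_x complex.Im (f2 x * (g x)^*%C)))); last first.
  rewrite -!Rintegral_lin //.
  have := Rintegral_lin 1 1 (integrable_lin a2 a1 r1 i1) (integrable_lin b2 b1 r2 i2).
  rewrite !mul1r => <-; apply: eq_Rintegral => x _ /=.
  by case: (f1 x) => ? ?; case: (f2 x) => ? ?; case: (g x) => ? ? /=; ring.
by apply/eqP; rewrite eq_complex /=; apply/andP; split; apply/eqP; ring.
Qed.

Lemma inner_sum (I : Type) (F : I -> T -> R[i]) (s : seq I) (c : I -> R[i]) g :
  (forall i, inL2 M (F i)) -> inL2 M g ->
  inL2 M (fun x => \sum_(i <- s) c i * F i x) /\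
  inner M (fun x => \sum_(i <- s) c i * F i x) g = \sum_(i <- s) c i * inner M (F i) g.
Proof.
move=> hF hg; elim: s => [|i s [IH1 IH2]].
  split; first by under eq_fun do rewrite big_nil; exact: inL2_0.
  rewrite big_nil /inner /cintegral.
  have e0 : \int[M]_(x in [set: T]) 0 = 0 :> R by rewrite Rintegral_cst // mul0r.
  by congr (_ +i* _)%C; rewrite -[RHS]e0; apply: eq_Rintegral => x _; rewrite big_nil mul0r.
have e : (fun x => \sum_(j <- i :: s) c j * F j x) =
         (fun x => c i * F i x + 1 * \sum_(j <- s) c j * F j x).
  by apply/funext => x; rewrite big_cons mul1r.
split; first by rewrite e; exact: inL2_lin.
by rewrite e inner_lin // IH2 big_cons mul1r.
Qed.

Lemma inner_real (f g : T -> R) :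
  inner M (fun x => (f x)%:C%C) (fun x => (g x)%:C%C) = (\int[M]_x (f x * g x))%:C%C.
Proof.
rewrite /inner /cintegral; congr (_ +i* _)%C.
  by apply: eq_Rintegral => x _ /=; ring.
have e0 : \int[M]_(x in [set: T]) 0 = 0 :> R by rewrite Rintegral_cst // mul0r.
by rewrite -[RHS]e0; apply: eq_Rintegral => x _ /=; ring.
Qed.

Lemma mass_le_integral_sqr (f : T -> R) x : measurable [set x] -> f \in Lfun M 2%:E ->
  fine (M [set x]) * f x ^+ 2 <= \int[M]_y (f y * f y).
Proof.
move=> mx hf; have hi := Lfun2_mul_integrable hf hf.
have -> : fine (M [set x]) * f x ^+ 2 = \int[M]_(y in [set x]) (f y * f y).
  rewrite (@eq_Rintegral _ _ _ _ _ (cst (f x * f x))); last by move=> y; rewrite inE => ->.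
  by rewrite Rintegral_cst // mulrC expr2.
rewrite /Rintegral fine_le //.
- exact: integrable_fin_num (integrableS measurableT mx (@subsetT _ _) hi).
- exact: integrable_fin_num hi.
- apply: ge0_subset_integral => //; first exact: measurable_int hi.
  by move=> y _; rewrite lee_fin -expr2 sqr_ge0.
Qed.

End InnerProduct.

Section MonicMorph.
Variables (F K : fieldType) (f : {rmorphism F -> K}) (q u v s p : F).

Lemma monic_coef_rmorph Q j :
  f (monic_coef q u v s p Q j) = monic_coef (f q) (f u) (f v) (f s) (f p) (f Q) j.
Proof.
suff : f (monic_coef q u v s p Q j) = monic_coef (f q) (f u) (f v) (f s) (f p) (f Q) j /\
       f (monic_coef q u v s p Q j.+1) = monic_coef (f q) (f u) (f v) (f s) (f p) (f Q) j.+1.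
  by case.
elim: j => [|j [IH1 IH2]]; split=> //.
- by rewrite !monic_coef0 rmorph1.
- by rewrite !monic_coef1 !(rmorph1, rmorphXn, fmorphV, rmorphM, rmorphB, rmorphD).
- rewrite !monic_coefSS -IH1 -IH2.
  by rewrite !(rmorph1, rmorphXn, fmorphV, rmorphM, rmorphB, rmorphD).
Qed.

Lemma monic_a_rmorph Q :
  f (monic_a q u v s p Q) = monic_a (f q) (f u) (f v) (f s) (f p) (f Q).
Proof. by rewrite /monic_a rmorphB !monic_coef_rmorph rmorphM. Qed.

Lemma monic_b_rmorph Q :
  f (monic_b q u v s p Q) = monic_b (f q) (f u) (f v) (f s) (f p) (f Q).
Proof.
rewrite /monic_b /monic_num.
by rewrite !(rmorph1, rmorphXn, fmorphV, rmorphM, rmorphB, rmorphD, rmorph_nat).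
Qed.

End MonicMorph.

Definition row_intpart n : intpart := Sub (row_part n) (is_row n).
Definition hook_intpart n : intpart := Sub [:: n.+1; 1%N] (is_hook n).

(** * Multiplication of row functions by h_1 *)

Section BigqJacobiRows.
Variables (R : realType) (q alpha beta : R) (gamma delta : R[i]) (s p : R).
Hypothesis hq : 0 < q < 1.
Hypotheses (alpha0 : alpha != 0) (beta0 : beta != 0) (gamma0 : gamma != 0).
Hypotheses (hs : gamma + delta = s%:C%C) (hp : gamma * delta = p%:C%C).
Hypothesis hc : p * (q / alpha * (q / beta)) < 0.

Local Notation u := (q / alpha).
Local Notation v := (q / beta).
Local Notation Q := (q%:C%C : R[i]).
Local Notation C := (real_complex R).
Local Notation g n j := (monic_coef q u v s p (q ^+ n) j).
Local Notation ma := (monic_a q u v s p).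
Local Notation mb := (monic_b q u v s p).
Local Notation h := (complete_at q alpha beta).
Local Notation Phi := (Phi q alpha beta gamma delta).

Let q0 : 0 < q. Proof. by case/andP: hq. Qed.

Let Q0 : Q != 0.
Proof. by rewrite fmorph_eq0 gt_eqF. Qed.

Let hQ i : 1 - Q ^+ i.+1 != 0.
Proof.
rewrite -rmorphXn -(rmorph1 C) -rmorphB fmorph_eq0 subr_eq0.
by rewrite gt_eqF // exprn_ilt1 // ?ltW //; case/andP: hq.
Qed.

Let ea : gamma / alpha%:C%C * Q = gamma * C u.
Proof. by rewrite fmorph_div mulrA mulrAC. Qed.

Let eb : gamma / beta%:C%C * Q = gamma * C v.
Proof. by rewrite fmorph_div mulrA mulrAC. Qed.

Let ec : gamma * delta / (alpha%:C%C * beta%:C%C) * Q ^+ 2 = C p * (C u * C v).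
Proof.
rewrite hp !fmorph_div; field.
by rewrite !fmorph_eq0 alpha0 beta0.
Qed.

Lemma generic_qX n : generic Q (C p * (C u * C v)) (Q ^+ n).
Proof.
split=> [|i k]; first by rewrite expf_neq0.
rewrite -!rmorphM -!rmorphXn -!rmorphM -rmorphB fmorph_eq0 gt_eqF //.
rewrite subr_gt0 (@lt_trans _ _ 0) ?exprn_gt0 // -mulrA nmulr_rlt0 //.
by rewrite mulr_gt0 ?exprn_gt0.
Qed.

Let gen n : generic Q (gamma * delta / (alpha%:C%C * beta%:C%C) * Q ^+ 2) (Q ^+ n).
Proof. by rewrite ec; exact: generic_qX. Qed.

Let pcE n j : pcoef Q (gamma / alpha%:C%C * Q) (gamma / beta%:C%C * Q)
    (gamma * delta / (alpha%:C%C * beta%:C%C) * Q ^+ 2) (Q ^+ n) j = gamma ^+ j * C (g n j).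
Proof.
rewrite ea eb ec (@pcoef_monic _ Q _ _ (C s) (C p) gamma delta) //; last exact: generic_qX.
by rewrite monic_coef_rmorph rmorphXn.
Qed.

(** The relation is proved over R[i], where gamma lives, and pulled back along the injective
    embedding of R. *)
Lemma real_monic_three n j : g n.+1 j.+2 =
  g n.+2 j.+2 + ma (q ^+ n.+1) * g n.+1 j.+1 + mb (q ^+ n.+1) * g n j.
Proof.
apply: (@complexI R); rewrite -!/(C _) 2!rmorphD 2!rmorphM monic_a_rmorph monic_b_rmorph.
rewrite !monic_coef_rmorph !rmorphXn.
have -> : Q ^+ n = Q ^+ n.+1 / Q by rewrite exprSr mulfK.
rewrite (exprS Q n.+1).
exact: (monic_three Q0 hQ gamma0 hs hp j (generic_qX n.+1)).
Qed.

Definition row_value n X : R := hconv (fun j => g n j) (h X) n.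

Lemma Phi_row_value n X : Phi (row_intpart n) X = (row_value n X)%:C%C.
Proof.
rewrite Phi_row // big_mkord /row_value /hconv (reindex_inj rev_ord_inj) /= -/(C _) rmorph_sum.
apply: eq_bigr => -[l ln] _ /=; rewrite ltnS in ln.
rewrite subSS subKn // pcE rmorphM; congr (_ * _).
have -> : gamma ^+ n = gamma ^+ (n - l) * gamma ^+ l by rewrite -exprD subnK.
by field; rewrite !expf_neq0.
Qed.

(** Hook Schur functions are h_1 h_(k+1) - h_(k+2). Up to lower terms, the hook function is
    therefore h_1 times a row function minus that row function with every h_k replaced by h_(k+1),
    and the three-term relation expands the latter. *)
Lemma hook_expansion n : exists A K : R[i], forall X,
  C (h X 1) * Phi (row_intpart n.+1) X =
  Phi (row_intpart n.+2) X + Phi (hook_intpart n) X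
  + A * Phi (row_intpart n.+1) X + C (mb (q ^+ n.+1)) * Phi (row_intpart n) X + K.
Proof.
have [K0 hK] := @Phi_hook R q alpha beta gamma delta hq gamma0 gen n.
pose x := g 0 1.
(* The hook sum ends at l = n; the terms l = n + 1 and l = n + 2 that complete the convolutions give
   the second part of the constant. *)
exists (C (ma (q ^+ n.+1) - x)), (- K0 + C (x * g n.+1 n.+1 - g n.+1 n.+2)) => X.
rewrite /hook_intpart hK.
have -> : \sum_(0 <= k < n.+1) gamma ^+ k.+1 / gamma ^+ n.+1 *
    pcoef Q (gamma / alpha%:C%C * Q) (gamma / beta%:C%C * Q)
      (gamma * delta / (alpha%:C%C * beta%:C%C) * Q ^+ 2) (Q ^+ n.+1) (n - k) *
    ((schur_at q alpha beta [:: k.+1; 1%N] X)%:C%C + gamma^-1 *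
      pcoef Q (gamma / alpha%:C%C * Q) (gamma / beta%:C%C * Q)
        (gamma * delta / (alpha%:C%C * beta%:C%C) * Q ^+ 2) 1 1 * (h X k.+1)%:C%C) =
    C (\sum_(l < n.+1) g n.+1 l *
        (h X 1 * h X (n.+1 - l) - h X (n.+2 - l) + x * h X (n.+1 - l))).
  rewrite big_mkord (reindex_inj rev_ord_inj) /= rmorph_sum.
  apply: eq_bigr => -[l ln] _ /=; rewrite ltnS in ln.
  rewrite subSS subKn // -[X in pcoef _ _ _ _ X 1](expr0 Q) !pcE schur_at_hook //.
  have -> : gamma ^+ n.+1 = gamma ^+ (n - l).+1 * gamma ^+ l.
    by rewrite -exprD addSn subnK.
  rewrite !subSn ?(leqW ln) // -/x expr1.
  move: (h X 1) (h X (n - l).+1) (h X (n - l).+2) (g n.+1 l) x => h1 h2 h3 gl x.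
  rewrite !(rmorphM, rmorphB, rmorphD) /=; field.
  by rewrite gamma0 !expf_neq0.
have three : hconv (fun j => g n.+1 j) (h X) n.+2 =
    row_value n.+2 X + ma (q ^+ n.+1) * row_value n.+1 X + mb (q ^+ n.+1) * row_value n X.
  by rewrite (hconv_monic_three real_monic_three).
set S := \sum_(l < n.+1) _.
have eS : S = h X 1 * row_value n.+1 X
    - hconv (fun j => g n.+1 j) (h X) n.+2 + x * row_value n.+1 X
    - x * g n.+1 n.+1 + g n.+1 n.+2.
  have e1 : row_value n.+1 X = \sum_(l < n.+1) g n.+1 l * h X (n.+1 - l) + g n.+1 n.+1.
    by rewrite /row_value /hconv big_ord_recr /= subnn complete_at0 mulr1.
  have e2 : hconv (fun j => g n.+1 j) (h X) n.+2 =
      \sum_(l < n.+1) g n.+1 l * h X (n.+2 - l) + g n.+1 n.+1 * h X 1 + g n.+1 n.+2.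
    rewrite /hconv 2!big_ord_recr /= subnn complete_at0 mulr1.
    by rewrite subSnn.
  rewrite e1 e2 /S.
  under eq_bigr do rewrite mulrDr mulrBr [_ * (x * _)]mulrCA [_ * (h X 1 * _)]mulrCA.
  rewrite !big_split /= sumrN -!mulr_sumr; ring.
rewrite !Phi_row_value eS three; move: (h X 1) (row_value n.+2 X) (row_value n.+1 X) (row_value n X).
move=> h1 r2 r1 r0; rewrite !(rmorphM, rmorphB, rmorphD) /=; ring.
Qed.

End BigqJacobiRows.

Lemma gaussian_exponent n : (4 * (n * n.+1) = n ^ 2 * 2 + (n * 2 + n ^ 2) * 2)%N.
Proof. by rewrite -mulnn mulnS; lia. Qed.

(** After a square root the bound contains r^(2n(n+1)), and 2n(n+1) = (n+1)^2 + n^2 - 1: one factor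
    is the wanted decay, the other absorbs the powers of K and B. *)
Lemma superexp_of_sqr (R : realType) (r : R) (T : nat -> R) A B :
  0 < r < 1 -> 0 <= A -> 0 <= B ->
  (forall n, T n.+1 ^+ 2 <= A * (B ^+ n * (r ^+ 4) ^+ (n * n.+1))) -> superexp r T.
Proof.
move=> hr A0 B0 hT K K1; have [r0 r1] := andP hr.
have K0 : 0 < K by apply: lt_le_trans K1.
have [D hD] := exp_gaussian_le hr (K ^+ 2 * B).
have D0 : 0 <= D by apply: le_trans (hD 0%N); rewrite !expr0 mulr1.
pose E := K ^+ 2 * A * D / r ^+ 2.
have E0 : 0 <= E by rewrite /E !mulr_ge0 ?invr_ge0 ?exprn_ge0 // ltW.
exists (`|T 0%N| + (1 + E)) => -[|n].
  by rewrite !expr0 mul1r mulr1 lerDl addr_ge0.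
apply: (@le_trans _ _ ((1 + E) * r ^+ (n.+1 ^ 2))); last first.
  by rewrite ler_wpM2r ?lerDr // exprn_ge0 // ltW.
have x0 : 0 <= K ^+ n.+1 * `|T n.+1| by rewrite mulr_ge0 ?exprn_ge0 // ltW.
have y0 : 0 <= (1 + E) * r ^+ (n.+1 ^ 2) by rewrite mulr_ge0 ?addr_ge0 ?exprn_ge0 // ltW.
rewrite -ler_sqr ?nnegrE // exprMn real_normK ?num_real //.
have h1 := ler_wpM2l (exprn_ge0 2 (exprn_ge0 n.+1 (ltW K0))) (hT n).
apply: (le_trans h1).
have -> : (K ^+ n.+1) ^+ 2 * (A * (B ^+ n * (r ^+ 4) ^+ (n * n.+1))) =
    K ^+ 2 * A / r ^+ 2 * ((K ^+ 2 * B) ^+ n * r ^+ (n ^ 2)) * r ^+ (n ^ 2)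
    * (r ^+ (n.+1 ^ 2)) ^+ 2.
  have -> : (r ^+ 4) ^+ (n * n.+1) = (r ^+ (n ^ 2)) ^+ 2 * (r ^+ (n * 2 + n ^ 2)) ^+ 2.
    by rewrite -!exprM -exprD gaussian_exponent.
  have -> : r ^+ (n.+1 ^ 2) = r * r ^+ (n * 2 + n ^ 2) by rewrite sqrnS exprS.
  have -> : (K ^+ n.+1) ^+ 2 = K ^+ 2 * (K ^+ 2) ^+ n by rewrite exprAC exprS.
  rewrite [(K ^+ 2 * B) ^+ n]exprMn.
  move: ((K ^+ 2) ^+ n) (r ^+ (n ^ 2)) (r ^+ (n * 2 + n ^ 2)) (B ^+ n) => x y z w; field.
  by rewrite gt_eqF.
rewrite [leRHS]exprMn ler_wpM2r ?sqr_ge0 //.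
(* The estimate is made on squares, and E <= (1 + E)^2 spares a root of E. *)
apply: (@le_trans _ _ E); last first.
  by have := sqr_ge0 E; rewrite sqrrD expr1n mul1r mulr2n; lra.
have rn1 : r ^+ (n ^ 2) <= 1 by rewrite exprn_ile1 // ltW.
rewrite -[leRHS]mulr1 ler_pM //.
- rewrite !mulr_ge0 ?invr_ge0 ?exprn_ge0 // ?mulr_ge0 ?exprn_ge0 // ltW //.
- by rewrite exprn_ge0 // ltW.
have -> : E = K ^+ 2 * A / r ^+ 2 * D by rewrite /E mulrAC.
by rewrite ler_wpM2l // !mulr_ge0 ?invr_ge0 ?exprn_ge0 // ltW.
Qed.

(** * Norm recursion and the mass of an atom *)

Section Orthogonality.
Variables (R : realType) (q alpha beta : R) (gamma delta : R[i]) (s p : R).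
Hypothesis hq : 0 < q < 1.
Hypotheses (alpha0 : alpha != 0) (beta0 : beta != 0) (gamma0 : gamma != 0).
Hypotheses (hs : gamma + delta = s%:C%C) (hp : gamma * delta = p%:C%C).
Hypothesis hc : p * (q / alpha * (q / beta)) < 0.
Variable M : probability BorelOmega R.
Hypothesis hM : orthogonal_basis M (Phi q alpha beta gamma delta).

Local Notation u := (q / alpha).
Local Notation v := (q / beta).
Local Notation C := (real_complex R).
Local Notation mb := (monic_b q u v s p).
Local Notation h := (complete_at q alpha beta).
Local Notation Phi := (Phi q alpha beta gamma delta).
Local Notation rv := (row_value q alpha beta s p).

Let PhiE n X : Phi (row_intpart n) X = (rv n X)%:C%C.
Proof. exact: (Phi_row_value hq alpha0 beta0 gamma0 hs hp hc). Qed.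

Let hL2 la : inL2 M (Phi la). Proof. by case: hM. Qed.
Let orth la mu : la <> mu -> inner M (Phi la) (Phi mu) = 0.
Proof. by case: hM => _ _ H _; exact: H. Qed.

Let rv0 X : rv 0 X = 1.
Proof. by rewrite /row_value /hconv big_ord1 complete_at0 mulr1. Qed.

Let row_neq n m : n <> m -> row_intpart n <> row_intpart m.
Proof. by move=> nm /(congr1 (fun la => sumn (val la))); rewrite !sumn_row. Qed.

Let hook_neq n m : hook_intpart n <> row_intpart m.
Proof. by move=> /(congr1 (fun la => size (val la))); case: m. Qed.

Definition row_norm n : R := \int[M]_X (rv n X * rv n X).

Definition gram i j : R[i] := inner M (Phi (row_intpart i)) (Phi (row_intpart j)).

Lemma gram_diag n : gram n n = (row_norm n)%:C%C.
Proof.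
rewrite /gram.
have -> : Phi (row_intpart n) = fun X => (rv n X)%:C%C by apply/funext => X; rewrite PhiE.
exact: inner_real.
Qed.

Lemma gram_off i j : i != j -> gram i j = 0.
Proof. by move=> /eqP ij; apply/orth/row_neq. Qed.

(** Pairing with a row removes the hook. The constant K is K Phi_(0) and meets only [gram 0 m]. *)
Lemma gram_mul n m :
  exists A K : R[i], (\int[M]_X (h X 1 * rv n.+1 X * rv m X))%:C%C =
  gram n.+2 m + A * gram n.+1 m + (mb (q ^+ n.+1))%:C%C * gram n m + K * gram 0 m.
Proof.
have [A [K e]] := hook_expansion hq alpha0 beta0 gamma0 hs hp hc n.
exists A, K.
pose l := [:: (1, row_intpart n.+2); (1, hook_intpart n); (A, row_intpart n.+1);
              ((mb (q ^+ n.+1))%:C%C, row_intpart n); (K, row_intpart 0)].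
(* The index type is that of pairs, so coefficients and functions are the two projections and
   partitions need no case analysis. *)
have [_] := @inner_sum _ _ _ M (R[i] * intpart)%type (fun i => Phi i.2) l (fun i => i.1) _
  (fun i => hL2 i.2) (hL2 (row_intpart m)).
rewrite /l !big_cons big_nil /= (orth (@hook_neq n m)) mulr0 !mul1r addr0 add0r !addrA => <-.
rewrite -inner_real; congr inner; apply/funext => X /=; last by rewrite PhiE.
rewrite !big_cons big_nil /= [Phi (row_intpart 0) X]PhiE rv0 mulr1 addr0 !mul1r.
transitivity (C (h X 1) * Phi (row_intpart n.+1) X); first by rewrite PhiE -rmorphM.
by rewrite e !addrA.
Qed.

(** The integral of h_1 Phi_(n+1) Phi_(n+2) is computed twice: expanding h_1 Phi_(n+1) leaves the
    norm of Phi_(n+2), expanding h_1 Phi_(n+2) leaves b times that of Phi_(n+1). *)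
Lemma row_norm_rec n : row_norm n.+2 = mb (q ^+ n.+2) * row_norm n.+1.
Proof.
have [A [K]] := gram_mul n n.+2; have [A' [K']] := gram_mul n.+1 n.+1.
move: gram_diag gram_off; move: gram => G diag off.
have lt i j : (i < j)%N -> G i j = 0 by move=> ij; rewrite off // neq_ltn ij.
have gt i j : (j < i)%N -> G i j = 0 by move=> ij; rewrite off // neq_ltn ij orbT.
rewrite (gt n.+3 n.+1) // (gt n.+2 n.+1) // (lt 0%N n.+1) //.
rewrite (lt n.+1 n.+2) // (lt n n.+2) // (lt 0%N n.+2) // !mulr0 !addr0 !add0r.
rewrite !diag -rmorphM => /(@complexI R) e1 /(@complexI R) e2.
by rewrite -e1 -e2; apply: eq_Rintegral => X _; rewrite mulrAC.
Qed.

Lemma row_norm_ge0 n : 0 <= row_norm n.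
Proof. by apply: Rintegral_ge0 => X _; rewrite -expr2 sqr_ge0. Qed.

Lemma row_norm_le : exists2 B, 0 <= B & forall n,
  row_norm n.+1 <= row_norm 1 * (B ^+ n * q ^+ (n * n.+1)).
Proof.
have [q0 q1] := andP hq.
have [B B0 hB] := monic_b_le s hq hc.
exists B => //; elim=> [|n IH]; first by rewrite !expr0 !mulr1.
rewrite row_norm_rec (le_trans (ler_norm _)) // normrM (ger0_norm (row_norm_ge0 _)).
apply: (@le_trans _ _ (B * q ^+ (n.+1 * 2) * row_norm n.+1)).
  by rewrite ler_wpM2r ?row_norm_ge0.
have h0 : 0 <= B * q ^+ (n.+1 * 2) by rewrite mulr_ge0 ?exprn_ge0 // ltW.
apply: le_trans (ler_wpM2l h0 IH) _.
rewrite le_eqVlt; apply/orP; left; apply/eqP.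
have -> : (n.+1 * n.+2 = n.+1 * 2 + n * n.+1)%N by rewrite [in RHS](mulnC n) -mulnDr.
by rewrite exprD exprS; ring.
Qed.

Lemma finite_mass0 (X : BorelOmega) : measurable [set X] ->
  finite_set [set i : grid_index | X i] -> M [set X] = 0%E.
Proof.
move=> mX fX; apply/eqP/negPn/negP => M0.
have m0 : 0 < fine (M [set X]).
  apply: fine_gt0; rewrite lt0e M0 measure_ge0 /=.
  exact: le_lt_trans (probability_le1 M mX) (ltry 1).
have [t ht] := @complete_at_finite R q alpha beta X fX.
have hL n : rv n \in Lfun M 2%:E.
  have -> : rv n = (fun Y => complex.Re (Phi (row_intpart n) Y)).
    by apply/funext => Y; rewrite PhiE.
  by case: (hL2 (row_intpart n)).
have [B B0 hB] := row_norm_le.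
apply: (hconv_not_superexp hq hc
  (real_monic_three hq gamma0 hs hp hc) (t := t)).
have -> : (fun n => hconv (fun j => monic_coef q u v s p (q ^+ n) j) (hsym t) n) =
    rv ^~ X.
  by apply/funext => n; rewrite /row_value; congr hconv; apply/funext => k; rewrite ht.
apply: (@superexp_of_sqr _ _ _ (row_norm 1 / fine (M [set X])) B) => //.
- exact: root4_bounds.
- by rewrite divr_ge0 ?row_norm_ge0 // ltW.
move=> n; rewrite root4X // mulrAC ler_pdivlMr // mulrC.
exact: le_trans (mass_le_integral_sqr mX (hL n.+1)) (hB n).
Qed.

End Orthogonality.

(** * The coefficients as printed *)

Section Alternating.
Variables (R : realType) (q c : R) (a b : R[i]) (t z : nat -> R[i]) (D : R).
Local Notation normc := (@Normc.normc R).
Local Notation C := (real_complex R).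
Hypothesis hq : 0 < q < 1.
Hypothesis hc : c < 0.
Hypothesis ha : forall m, 1 - a * C q ^+ m != 0.
Hypothesis hb : forall m, 1 - b * C q ^+ m != 0.

Definition factor_ratio m : R[i] :=
  (1 - a * C q ^+ m) * (1 - b * C q ^+ m) / ((1 - C q ^+ m.+1) * (1 - C c * C q ^+ m)).

Hypothesis t0 : t 0 = 1.
Hypothesis tS : forall m, t m.+1 = t m * factor_ratio m.
Hypothesis zD : forall k, normc (z k) <= D * q ^+ k.
Hypothesis tz : forall m,
  t m = \sum_(k < m.+1) (-1) ^+ (m - k) * (z k / qpoch (C q) (C q) (m - k)).

Let q0 : 0 < q. Proof. by case/andP: hq. Qed.
Let q1 : q < 1. Proof. by case/andP: hq. Qed.
Let r := root4 q.
Let hr : 0 < r < 1. Proof. exact: root4_bounds. Qed.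
Let r0 : 0 < r. Proof. by case/andP: hr. Qed.
Let r1 : r < 1. Proof. by case/andP: hr. Qed.
Let r1' : 0 < 1 - r. Proof. by rewrite subr_gt0. Qed.

Lemma normc_real (x : R) : normc (C x) = `|x|.
Proof. by rewrite /= expr0n /= addr0 sqrtr_sqr. Qed.

Lemma normc_ge0 x : 0 <= normc x.
Proof. by case: x => x y; exact: sqrtr_ge0. Qed.

Lemma normc_gt0 x : x != 0 -> 0 < normc x.
Proof.
move=> x0; rewrite lt_def normc_ge0 andbT; apply: contra x0 => /eqP.
by move=> /Normc.eq0_normc ->.
Qed.

Lemma normc_tri x y : normc (x + y) <= normc x + normc y.
Proof. exact: le_normcD. Qed.

Lemma normc_sign n x : normc ((-1) ^+ n * x) = normc x.
Proof.
elim: n => [|n IH]; first by rewrite mul1r.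
by rewrite exprS mulN1r mulNr [LHS]normcN.
Qed.

Lemma normc_sum n (F : nat -> R[i]) :
  normc (\sum_(k < n) F k) <= \sum_(k < n) normc (F k).
Proof.
elim: n => [|n IH]; first by rewrite !big_ord0 Normc.normc0.
by rewrite !big_ord_recr /= (le_trans (normc_tri _ _)) // lerD2r.
Qed.

Lemma exp_small (x K e : R) : 0 < x < 1 -> 0 < e -> 0 <= K ->
  exists N, forall m, (N <= m)%N -> K * x ^+ m <= e.
Proof.
move=> /andP[x0 x1] e0 K0.
have /cvgrPdist_le/(_ e e0)[N _ hN] : (fun m => K * x ^+ m) @ \oo --> 0.
  rewrite -[X in _ --> X](mulr0 K); apply: cvgM; first exact: cvg_cst.
  by apply: cvg_expr; rewrite gtr0_norm.
exists N => m Nm; have := hN m Nm; rewrite sub0r normrN ger0_norm //.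
by rewrite mulr_ge0 // exprn_ge0 // ltW.
Qed.

Lemma geometric_lower (w : nat -> R) (x : R) N : 0 < x -> (forall j, 0 < w j) ->
  (forall j, (N <= j)%N -> x * w j <= w j.+1) ->
  exists2 e, 0 < e & forall j, e * x ^+ j <= w j.
Proof.
move=> x0 w0 hw.
have [e e0 he] : exists2 e, 0 < e & forall j, (j <= N)%N -> e * x ^+ j <= w j.
  elim: (N) => [|k [e e0 he]].
    by exists (w 0%N) => // j; rewrite leqn0 => /eqP ->; rewrite mulr1.
  exists (Num.min e (w k.+1 / x ^+ k.+1)).
    by rewrite lt_min e0 divr_gt0 // exprn_gt0.
  move=> j; rewrite leq_eqVlt => /orP[/eqP ->|jk].
    by rewrite -ler_pdivlMr ?exprn_gt0 // ge_min lexx orbT.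
  apply: le_trans (he j jk); rewrite ler_pM2r ?exprn_gt0 //.
  by rewrite ge_min lexx.
exists e => // j; have [/he //|Nj] := leqP j N.
rewrite -(subnK (ltnW Nj)); elim: (j - N)%N => [|i IH]; first exact: he.
rewrite addSn; apply: le_trans (hw _ (leq_addl _ _)).
by rewrite exprS mulrCA ler_pM2l.
Qed.

(** A bound (q; q)_j >= r^j up to a constant suffices below, and it follows from 1 - q^(j+1) >= r
    for large j. *)
Lemma qpoch_lower : exists2 e, 0 < e & forall j, normc (qpoch (C q) (C q) j)^-1 <= e / r ^+ j.
Proof.
pose w j := \prod_(i < j) (1 - q ^+ i.+1).
have w0 j : 0 < w j.
  by apply: prodr_gt0 => i _; rewrite subr_gt0 exprn_ilt1 // ltW.
have [N hN] := exp_small hq r1' ler01.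
have hw j : (N <= j)%N -> r * w j <= w j.+1.
  move=> Nj; rewrite [w j.+1]big_ord_recr /= mulrC ler_pM2l //.
  rewrite lerBrDr -lerBrDl -[q ^+ _]mul1r.
  by apply: hN; exact: leqW.
have [e e0 he] := geometric_lower r0 w0 hw.
exists e^-1; first by rewrite invr_gt0.
move=> j; have -> : qpoch (C q) (C q) j = C (w j).
  by rewrite /qpoch rmorph_prod; apply: eq_bigr => i _; rewrite -exprS rmorphB rmorph1 rmorphXn.
rewrite Normc.normcV normc_real gtr0_norm // -invfM lef_pV2 ?posrE //.
by rewrite mulr_gt0 // exprn_gt0.
Qed.

Lemma factor_ratio_near1 : exists2 K, 0 <= K & forall m, normc (factor_ratio m - 1) <= K * q ^+ m.
Proof.
pose K0 := normc a + normc b + normc (a * b) + q + `|c| + `|c| * q.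
have K00 : 0 <= K0 by rewrite !addr_ge0 ?mulr_ge0 ?normc_ge0 // ltW.
exists (K0 / (1 - q)) => [|m]; first by rewrite divr_ge0 // subr_ge0 ltW.
pose x := q ^+ m; have x0 : 0 < x by rewrite exprn_gt0.
have x1 : x <= 1 by rewrite exprn_ile1 // ltW.
pose d := (1 - q * x) * (1 - c * x).
have d1 : 1 - q <= d.
  have h1 : 1 - q <= 1 - q * x by rewrite lerD2l lerN2 ger_pMr.
  have h2 : 1 <= 1 - c * x by rewrite lerDl oppr_ge0 mulr_le0_ge0 // ltW.
  rewrite -[leLHS]mulr1 ler_pM ?subr_ge0 // ltW //.
have d0 : 0 < d by apply: lt_le_trans d1; rewrite subr_gt0.
have -> : factor_ratio m - 1 = (- a - b + a * b * C x + C q + C c - C c * C q * C x) * C x * C d^-1.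
  have dC : C d != 0 by rewrite fmorph_eq0 gt_eqF.
  have eX : C q ^+ m = C x by rewrite -rmorphXn.
  have ed : C d = (1 - C q * C x) * (1 - C c * C x).
    by rewrite /d rmorphM !rmorphB !rmorphM rmorph1.
  move: dC; rewrite fmorphV ed mulf_eq0 negb_or => /andP[d2 d3].
  by rewrite /factor_ratio exprS eX /= ed; field; rewrite d2 d3.
have dV0 : 0 <= d^-1 by rewrite invr_ge0 ltW.
rewrite !Normc.normcM !normc_real (gtr0_norm x0) (ger0_norm dV0) -/x.
rewrite [leRHS]mulrAC ler_pM ?mulr_ge0 ?normc_ge0 ?(ltW x0) //; last first.
  by rewrite lef_pV2 ?posrE ?subr_gt0.
rewrite ler_pM2r //.
have hx y : normc (y * C x) <= normc y.
  by rewrite Normc.normcM normc_real gtr0_norm // ler_piMr ?normc_ge0.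
have nN y : normc (- y) = normc y by exact: normcN.
apply: le_trans (normc_tri _ _) (lerD _ _); last first.
  by rewrite nN (le_trans (hx _)) // Normc.normcM !normc_real (gtr0_norm q0).
apply: le_trans (normc_tri _ _) (lerD _ _); last by rewrite normc_real.
apply: le_trans (normc_tri _ _) (lerD _ _); last by rewrite normc_real gtr0_norm.
apply: le_trans (normc_tri _ _) (lerD _ (hx _)).
by apply: le_trans (normc_tri _ _) _; rewrite !nN.
Qed.

(* Since 1 / (q; q)_(j+1) - 1 / (q; q)_j = q^(j+1) / (q; q)_(j+1), the sum of
   consecutive terms gains a factor q^(m+1-k). *)
Lemma t_sum_small : exists2 K, 0 <= K & forall m, normc (t m.+1 + t m) <= K * r ^+ (3 * m).
Proof.
have D0 : 0 <= D.
  by have := zD 0; rewrite expr0 mulr1; apply: le_trans; exact: normc_ge0.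
have [e e0 he] := qpoch_lower.
exists (D * e / (1 - r)) => [|m]; first by rewrite divr_ge0 ?mulr_ge0 ?(ltW e0) ?(ltW r1').
pose F k := (-1) ^+ (m.+1 - k) * (z k * (C q ^+ (m.+1 - k) / qpoch (C q) (C q) (m.+1 - k))).
have -> : t m.+1 + t m = \sum_(k < m.+2) F k.
  rewrite /F !tz big_ord_recr [RHS]big_ord_recr /= subnn expr0 mul1r addrAC -big_split /=.
  congr (_ + _); last by rewrite ?mul1r.
  apply: eq_bigr => -[k km] _ /=; rewrite ltnS in km.
  rewrite subSn // (qpochSr _ (C q)) -exprS exprS.
  set x := qpoch _ _ _.
  have x0 : x != 0.
    apply/prodf_neq0 => i _; rewrite -exprS -rmorphXn -(rmorph1 C) -rmorphB fmorph_eq0.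
    by rewrite subr_eq0 gt_eqF // exprn_ilt1 // ltW.
  have y0 : 1 - C q ^+ (m - k).+1 != 0.
    rewrite -rmorphXn -(rmorph1 C) -rmorphB fmorph_eq0.
    by rewrite subr_eq0 gt_eqF // exprn_ilt1 // ltW.
  by field; rewrite x0 y0.
apply: (le_trans (normc_sum m.+2 F)).
(* Since q = r^4, the bound q^(m+1) / r^(m+1-k) equals r^(3(m+1)) r^k, which is summable in k. *)
apply: (@le_trans _ _ (\sum_(k < m.+2) D * e * r ^+ (3 * m) * r ^+ k)).
  apply: ler_sum => -[k km] _ /=; rewrite ltnS in km.
  rewrite /F normc_sign Normc.normcM Normc.normcM -rmorphXn normc_real ger0_norm ?exprn_ge0 ?(ltW q0) //.
  apply: (@le_trans _ _ (D * q ^+ k * (q ^+ (m.+1 - k) * (e / r ^+ (m.+1 - k))))).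
    by rewrite ler_pM ?normc_ge0 ?mulr_ge0 ?normc_ge0 ?exprn_ge0 ?(ltW q0) // ler_wpM2l ?exprn_ge0 ?(ltW q0).
  have -> : D * q ^+ k * (q ^+ (m.+1 - k) * (e / r ^+ (m.+1 - k))) =
      D * e * r ^+ (3 * m.+1) * r ^+ k.
    have -> : r ^+ (3 * m.+1) = r ^+ (3 * (m.+1 - k)) * r ^+ (3 * k).
      by rewrite -exprD -mulnDr subnK.
    rewrite -{1 2}(root4X hq) -/r -!exprM !mulSn !exprD !mul0n !expr0.
    by field; rewrite expf_neq0 // gt_eqF.
  rewrite ler_wpM2r ?exprn_ge0 ?(ltW r0) // ler_wpM2l ?mulr_ge0 ?(ltW e0) //.
  by rewrite ler_wiXn2l ?(ltW r0) ?(ltW r1) // leq_mul2l leqnSn orbT.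
rewrite -mulr_sumr [leRHS]mulrAC ler_wpM2l ?mulr_ge0 ?exprn_ge0 ?(ltW e0) ?(ltW r0) //.
rewrite -[leRHS]mul1r ler_pdivlMr // mulrC -opprB mulNr -subrX1 opprB.
by rewrite gerBl exprn_ge0 // ltW.
Qed.

(** Ratios tending to 1 keep |t_m| above a multiple of r^m and make |t_(m+1) + t_m| at least |t_m|
    for large m, against the upper bound of order r^(3m). *)
Lemma alternating_absurd : False.
Proof.
have [K1 K10 hK1] := factor_ratio_near1; have [K K0 hK] := t_sum_small.
have ratio0 m : factor_ratio m != 0.
  have h k : 1 - C q ^+ k.+1 != 0.
    rewrite -rmorphXn -(rmorph1 C) -rmorphB fmorph_eq0.
    by rewrite subr_eq0 gt_eqF // exprn_ilt1 // ltW.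
  have h' : 1 - C c * C q ^+ m != 0.
    rewrite -rmorphXn -rmorphM -(rmorph1 C) -rmorphB fmorph_eq0 gt_eqF //.
    by rewrite subr_gt0 (@lt_trans _ _ 0) // nmulr_rlt0 // exprn_gt0.
  by rewrite /factor_ratio !mulf_neq0 // invr_eq0 mulf_neq0.
have tn0 m : 0 < normc (t m).
  elim: m => [|m IH]; first by rewrite t0 Normc.normc1.
  by rewrite tS Normc.normcM mulr_gt0 // normc_gt0.
have [N hN] := exp_small hq r1' K10.
have near m : (N <= m)%N -> normc (factor_ratio m - 1) <= 1 - r.
  by move=> Nm; apply: le_trans (hK1 m) (hN m Nm).
have step m : (N <= m)%N -> r * normc (t m) <= normc (t m.+1).
  move=> Nm; rewrite tS Normc.normcM mulrC ler_wpM2l ?normc_ge0 //.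
  have := normc_tri (factor_ratio m) (1 - factor_ratio m); rewrite addrC subrK Normc.normc1.
  have -> : normc (1 - factor_ratio m) = normc (factor_ratio m - 1) by rewrite -opprB [LHS]normcN.
  by have := near m Nm; lra.
have [e e0 he] := geometric_lower r0 tn0 step.
have e20 : 0 < e / 2 by rewrite divr_gt0.
have [N' hN'] := exp_small hr e20 K0.
pose m := maxn N N'.
have h1 : normc (t m) <= normc (t m.+1 + t m).
  have -> : t m.+1 + t m = t m * (factor_ratio m + 1) by rewrite tS mulrDr mulr1.
  rewrite Normc.normcM ler_peMr ?normc_ge0 //.
  have := normc_tri (factor_ratio m + 1) (- (factor_ratio m - 1)).
  rewrite (_ : _ + 1 + _ = C 2); last by rewrite rmorph_nat; ring.
  rewrite normc_real normr_nat [X in _ <= _ + X]normcN.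
  by have := near m (leq_maxl _ _); have := r0; lra.
have h2 : K * r ^+ (3 * m) <= e / 2 * r ^+ m.
  apply: le_trans (ler_wpM2r (ltW (exprn_gt0 m r0)) (hN' m (leq_maxr _ _))).
  rewrite -mulrA ler_wpM2l // -exprD ler_wiXn2l ?(ltW r0) ?(ltW r1) //.
  by rewrite addnn -mul2n leq_mul2r orbT.
have := he m; have := le_trans h1 (le_trans (hK m) h2).
have : 0 < e * r ^+ m by rewrite mulr_gt0 // exprn_gt0.
rewrite (_ : e / 2 * r ^+ m = e * r ^+ m / 2); last by rewrite mulrAC.
by move: (e * r ^+ m) (normc (t m)) => x y; lra.
Qed.

End Alternating.

Section InnerNatSum.
Variables (R : realType) (d : measure_display) (T : measurableType d).
Variable M : probability T R.

Lemma inner_nat_sum n (F : nat -> T -> R[i]) (c : nat -> R[i]) g :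
  (forall i, (i < n)%N -> inL2 M (F i)) -> inL2 M g ->
  inL2 M (fun x => \sum_(0 <= i < n) c i * F i x) /\
  inner M (fun x => \sum_(0 <= i < n) c i * F i x) g
  = \sum_(0 <= i < n) c i * inner M (F i) g.
Proof.
move=> hF hg; pose G (i : 'I_n) := F i.
have [h1 h2] := inner_sum (index_enum 'I_n) (fun i => c i)
  (fun i => hF i (ltn_ord i) : inL2 M (G i)) hg.
have e : (fun x => \sum_(0 <= i < n) c i * F i x) = (fun x => \sum_(i <- index_enum 'I_n) c i * G i x).
  by apply/funext => x; rewrite big_mkord.
by rewrite e h2 big_mkord.
Qed.

End InnerNatSum.

(** * Moments forced by orthogonality to 1 *)

Section Moments.
Variables (F : fieldType) (q a b c : F).
Hypothesis q0 : q != 0.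
Hypothesis hq : forall i, 1 - q ^+ i.+1 != 0.
Hypothesis gen : forall n, generic q c (q ^+ n).

Fixpoint moment_factor m : F :=
  if m is m'.+1 then moment_factor m' *
    ((1 - a * q ^+ m') * (1 - b * q ^+ m') / ((1 - q ^+ m'.+1) * (1 - c * q ^+ m')))
  else 1.

(** The solution, with value 1 at m = 0, of the triangular system in [moment_annihilates]; for the
    printed functions (-1)^m E[J_m], with J_m = [Jfun m], solves the same system. *)
Definition moment m := (-1) ^+ m * moment_factor m / q ^+ 'C(m, 2).

(* [L m] is an eigenvalue of the operator whose eigenvectors have the
   coefficients [dcoef]; multiplied by [L n], the sum telescopes. *)
Lemma moment_annihilates n : (0 < n)%N ->
  \sum_(0 <= m < n.+1) dcoef q a b c (q ^+ n) (n - m) * moment m = 0.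
Proof.
move=> n0.
have hc k : 1 - c * q ^+ k != 0.
  have [_ /(_ 0%N k)] := gen 0; by rewrite !expr0 expr1n mulr1.
pose L m := (1 - q ^+ m) * (q - c * q ^+ m) / q ^+ m.
pose Y m := L m * dcoef q a b c (q ^+ n) (n - m) * moment m.
have hL : L n != 0.
  have [_ /(_ 1%N n)] := gen 0; rewrite expr0 expr1n mulr1 expr1 => h.
  by case: n n0 h @Y => // n _ h _; rewrite /L !mulf_neq0 // invr_eq0 expf_neq0.
apply: (mulfI hL); rewrite mulr0 mulr_sumr.
rewrite big_nat_recr //= subnn mul1r.
have -> : \sum_(0 <= m < n) L n * (dcoef q a b c (q ^+ n) (n - m) * moment m) =
    \sum_(0 <= m < n) (Y m - Y m.+1).
  apply: eq_big_nat => m /andP[_ mn].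
  have [k ek] : exists k, (n = m.+1 + k)%N by exists (n - m.+1)%N; rewrite subnKC.
  have e1 : (n - m.+1)%N = k by rewrite ek addnC addnK.
  have e2 : (n - m)%N = k.+1 by rewrite ek addSnnS addnC addnK.
  rewrite /Y /L e1 e2 /moment /= binS bin1.
  have -> : q ^+ n = q ^+ m * q ^+ k.+1 by rewrite ek addSnnS exprD.
  have := hc (m + m + k)%N; have := hc m; have := hq m; have := hq k.
  rewrite !exprD !(exprSr q) (exprSr (-1)).
  have := expf_neq0 'C(m, 2) q0; have := expf_neq0 m q0; have := expf_neq0 k q0.
  move: (dcoef _ _ _ _ _ _) (moment_factor m) ((-1) ^+ m) (q ^+ 'C(m, 2)) => D f sg w.
  set x := q ^+ m; set y := q ^+ k => y0 x0 w0 h1 h2 h3 h4.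
  have -> : c * (x * (y * q)) ^+ 2 / (y * q * q) = c * (x * x * y).
    by field; rewrite q0 y0.
  by field; rewrite q0 x0 y0 w0 h1 h2 h3 h4.
(* The telescoped sum is Y 0 - Y n: the first vanishes with L 0, the second cancels the term m = n
   set aside. *)
under eq_bigr do rewrite -opprB.
rewrite sumrN telescope_sumr // /Y subnn /L !expr0 subrr !mul0r subr0.
by rewrite mulr1 addNr.
Qed.

End Moments.

(** * Contradiction for the printed functions *)

Section Printed.
Variables (R : realType) (q alpha beta c : R) (gamma delta : R[i]).
Hypothesis hq : 0 < q < 1.
Hypothesis hc : c < 0.
Hypothesis gamma0 : gamma != 0.

Local Notation C := (real_complex R).
Local Notation Q := (q%:C%C : R[i]).
Local Notation ca := (gamma / (alpha%:C%C : R[i]) * Q).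
Local Notation cb := (gamma / (beta%:C%C : R[i]) * Q).
Local Notation cc := (gamma * delta / ((alpha%:C%C : R[i]) * (beta%:C%C : R[i])) * Q ^+ 2).
Local Notation h := (complete_at q alpha beta).
Local Notation dc n i := (dcoef Q ca cb cc (Q ^+ n) i).
Local Notation sc m i := (scoef Q (Q ^+ m) i).

Hypothesis hcc : cc = C c.
Hypothesis gen : forall n, generic Q cc (Q ^+ n).
Hypothesis ha : forall m, 1 - ca * Q ^+ m != 0.
Hypothesis hb : forall m, 1 - cb * Q ^+ m != 0.
Variable M : probability BorelOmega R.
Hypothesis hM : orthogonal_basis M (Phi_printed q alpha beta gamma delta).

Local Notation Phi := (Phi_printed q alpha beta gamma delta).

Let q0 : 0 < q. Proof. by case/andP: hq. Qed.
Let q1 : q < 1. Proof. by case/andP: hq. Qed.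
Let Q0 : Q != 0. Proof. by rewrite fmorph_eq0 gt_eqF. Qed.
Let hQ i : 1 - Q ^+ i.+1 != 0.
Proof.
rewrite -rmorphXn -(rmorph1 C) -rmorphB fmorph_eq0 subr_eq0.
by rewrite gt_eqF // exprn_ilt1 // ltW.
Qed.

Let hL2 la : inL2 M (Phi la). Proof. by case: hM. Qed.

Definition hfun k (X : BorelOmega) : R[i] := C (h X k).
Definition Jfun m (X : BorelOmega) : R[i] := \sum_(0 <= k < m.+1) sc m (m - k) * hfun k X.
Definition one_fun (X : BorelOmega) : R[i] := 1.

Lemma Phi_printed_J n : Phi (row_intpart n) = fun X => gamma ^- n *
  \sum_(0 <= m < n.+1) ((-1) ^+ (n - m) * dc n (n - m)) * Jfun m X.
Proof. by apply/funext => X; rewrite /row_intpart (Phi_printed_row hq gamma0 gen). Qed.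

Lemma hfun0 : hfun 0 = one_fun.
Proof. by apply/funext => X; rewrite /hfun complete_at0. Qed.

Lemma Phi_printed_one : Phi (row_intpart 0) = one_fun.
Proof.
apply/funext => X; rewrite Phi_printed_J /Jfun !big_nat1 hfun0 /= expr0.
by rewrite invr1 !mul1r.
Qed.

Lemma inL2_one : inL2 M one_fun.
Proof. by rewrite -Phi_printed_one. Qed.

(** Square integrability of h_n, measurability included, is read off from the Phi's: they are
    triangular in the h_k, with diagonal coefficients gamma^-n. *)
Lemma inL2_hfun n : inL2 M (hfun n).
Proof.
have [k] := ubnP n; elim: k n => // k IH n; rewrite ltnS => nk.
have IH' i : (i < n)%N -> inL2 M (hfun i) by move=> ij; apply: IH; exact: leq_trans nk.
have hJ m : (m < n)%N -> inL2 M (Jfun m).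
  move=> mn; apply: (proj1 (inner_nat_sum (fun k => sc m (m - k)) _ inL2_one)) => i im.
  by apply: IH'; exact: leq_trans mn.
have [h1 _] := inner_nat_sum (fun m => (-1) ^+ (n - m) * dc n (n - m)) hJ inL2_one.
have [h2 _] := inner_nat_sum (fun k => sc n (n - k)) IH' inL2_one.
have -> : hfun n = fun X => gamma ^+ n * Phi (row_intpart n) X + -1 *
   (1 * (\sum_(0 <= m < n) ((-1) ^+ (n - m) * dc n (n - m)) * Jfun m X)
    + 1 * \sum_(0 <= k < n) sc n (n - k) * hfun k X).
  apply/funext => X; rewrite Phi_printed_J mulVKf ?expf_neq0 // big_nat_recr //=.
  rewrite {2}/Jfun big_nat_recr //= subnn expr0 /= !mul1r; ring.
by apply: inL2_lin => //; exact: inL2_lin.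
Qed.

Definition evalue k := inner M (hfun k) one_fun.
Definition wvalue m := inner M (Jfun m) one_fun.

Lemma wvalueE m : wvalue m = \sum_(0 <= k < m.+1) sc m (m - k) * evalue k.
Proof.
exact: (proj2 (inner_nat_sum (fun k => sc m (m - k)) (fun i _ => inL2_hfun i) inL2_one)).
Qed.

Lemma inL2_Jfun m : inL2 M (Jfun m).
Proof.
exact: (proj1 (inner_nat_sum (fun k => sc m (m - k)) (fun i _ => inL2_hfun i) inL2_one)).
Qed.

Lemma evalueE k : evalue k = C (\int[M]_X h X k).
Proof.
rewrite /evalue (_ : one_fun = fun X => C (cst 1 X)) // inner_real; congr C.
by apply: eq_Rintegral => X _; rewrite mulr1.
Qed.

Lemma evalue0 : evalue 0 = 1.
Proof.
rewrite evalueE (@eq_Rintegral _ _ _ _ _ (cst 1)) => [|X _]; last by rewrite complete_at0.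
by rewrite Rintegral_cst // mul1r [X in fine X]probability_setT.
Qed.

(** Multiplied by (-1)^n, the printed sign (-1)^(n-m) becomes (-1)^m and attaches to the
    unknowns. *)
Lemma wvalue_sum n : (0 < n)%N ->
  \sum_(0 <= m < n.+1) dc n (n - m) * ((-1) ^+ m * wvalue m) = 0.
Proof.
move=> n0; have h0 : inner M (Phi (row_intpart n)) one_fun = 0.
  rewrite -Phi_printed_one; case: hM => _ _ + _; apply.
  move=> /(congr1 (fun la => sumn (val la))); rewrite !sumn_row => e.
  by rewrite e in n0.
have [h1 h2] := inner_nat_sum (n := n.+1) (fun m => (-1) ^+ (n - m) * dc n (n - m))
  (fun i _ => inL2_Jfun i) inL2_one.
have h3 : inner M (Phi (row_intpart n)) one_fun = gamma ^- n *
    \sum_(0 <= m < n.+1) ((-1) ^+ (n - m) * dc n (n - m)) * wvalue m.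
  rewrite -h2 Phi_printed_J.
  have := inner_lin (gamma ^- n) 0 h1 (inL2_0 M) inL2_one.
  rewrite (mul0r (inner _ _ _)) addr0 => <-; congr (inner _ _ _); apply/funext => X.
  by rewrite mul0r addr0.
have : gamma ^- n *
    \sum_(0 <= m < n.+1) ((-1) ^+ (n - m) * dc n (n - m)) * wvalue m = 0 by rewrite -h3.
move=> /eqP; rewrite mulf_eq0 invr_eq0 expf_eq0 (negbTE gamma0) andbF /= => /eqP e.
transitivity ((-1) ^+ n * \sum_(0 <= m < n.+1) ((-1) ^+ (n - m) * dc n (n - m)) * wvalue m).
  rewrite mulr_sumr; apply: eq_big_nat => m /andP[_ mn]; rewrite ltnS in mn.
  rewrite -[in (-1) ^+ n](subnK mn) exprD mulrA.
  move: (dc _ _) (wvalue m) ((-1) ^+ m) => d w x.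
  by rewrite -!mulrA [in RHS](mulrCA x) signrMK; ring.
by rewrite e mulr0.
Qed.

(** The system is triangular with unit diagonal, so its solution is determined by the value 1 at m =
    0. *)
Lemma wvalueE_factor m : wvalue m = moment_factor Q ca cb cc m / Q ^+ 'C(m, 2).
Proof.
suff : (-1) ^+ m * wvalue m = moment Q ca cb cc m.
  by rewrite /moment -mulrA => /(can_inj (signrMK m)).
have [k] := ubnP m; elim: k m => // k IH [|m]; rewrite ltnS => mk.
  by rewrite wvalueE big_nat1 evalue0 /moment /= !expr0 invr1 !mul1r.
have := wvalue_sum (ltn0Sn m); rewrite big_nat_recr //= subnn mul1r => /eqP.
rewrite addr_eq0 => /eqP e1.
have := moment_annihilates ca cb Q0 hQ gen (ltn0Sn m).
rewrite big_nat_recr //= subnn mul1r => /eqP; rewrite addr_eq0 => /eqP e2.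
apply: oppr_inj; rewrite -e1 -e2.
apply: eq_big_nat => i /andP[_ im]; congr (_ * _); apply: IH.
exact: leq_trans mk.
Qed.

Lemma factor_sum m : moment_factor Q ca cb cc m =
  \sum_(k < m.+1) (-1) ^+ (m - k) * (Q ^+ 'C(k, 2) * evalue k / qpoch Q Q (m - k)).
Proof.
have := wvalueE m; rewrite wvalueE_factor => /(canRL (divfK (expf_neq0 _ Q0))) ->.
rewrite big_mkord mulr_suml; apply: eq_bigr => -[k km] _ /=; rewrite ltnS in km.
rewrite scoefE ?leq_subr // subKn //.
have := expf_neq0 'C(m, 2) Q0; have : qpoch Q Q (m - k) != 0.
  rewrite /qpoch; apply/prodf_neq0 => i _; rewrite -exprS; exact: hQ.
move: (qpoch _ _ _) (Q ^+ 'C(m, 2)) (Q ^+ 'C(k, 2)) ((-1) ^+ _) => x y w e x0 y0.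
by field; rewrite x0 y0.
Qed.

Lemma integral_complete_le k : `|\int[M]_X h X k| <= points_bound q alpha beta ^+ k.
Proof.
have hi : M.-integrable setT (EFin \o (fun X : BorelOmega => h X k)).
  have := Lfun2_mul_integrable (proj1 (inL2_hfun k)) (proj1 inL2_one).
  by congr (_.-integrable _ _); apply/funext => X /=; rewrite mulr1.
apply: (le_trans (le_normr_Rintegral _ hi)) => //.
have -> : points_bound q alpha beta ^+ k =
    \int[M]_(X in [set: BorelOmega]) (cst (points_bound q alpha beta ^+ k) X).
  by rewrite Rintegral_cst // [X in fine X]probability_setT mulr1.
apply: le_Rintegral => //.
- exact: (integrable_norm hi).
- exact: finite_measure_integrable_cst.
- by move=> X _; exact: complete_at_le.
Qed.

Lemma bin2_sqr k : (k ^ 2 = k + 2 * 'C(k, 2))%N.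
Proof. by elim: k => // k IH; rewrite binS bin1 -addn1 sqrnD; lia. Qed.

Lemma evalue_bound : exists D, forall k,
  Normc.normc (Q ^+ 'C(k, 2) * evalue k) <= D * q ^+ k.
Proof.
have [r0 r1] := andP (root4_bounds hq); set r := root4 q in r0 r1.
have qX n : q ^+ n = r ^+ (4 * n) by rewrite exprM [r ^+ 4](root4X hq).
(* In terms of r, q^C(k,2) is r^(2k^2) r^(-2k), and division by q^k gives r^(-4k), whence r^6. One
   factor r^(k^2) absorbs the exponentials. *)
have [B hB] := exp_gaussian_le (root4_bounds hq) (points_bound q alpha beta / r ^+ 6).
exists B => k; rewrite evalueE -rmorphXn -rmorphM normc_real normrM.
rewrite ger0_norm ?exprn_ge0 ?(ltW q0) //.
apply: (le_trans (ler_wpM2l _ (integral_complete_le k))).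
  by rewrite exprn_ge0 // ltW.
have q0' := exprn_gt0 k q0.
rewrite -ler_pdivrMr //; apply: le_trans (hB k).
have P0 : 0 <= points_bound q alpha beta ^+ k.
  by apply: exprn_ge0; apply: le_trans (points_bound_ge1 alpha beta hq).
rewrite -/r exprMn exprVn !qX -exprM.
have e : r ^+ (4 * 'C(k, 2)) = r ^+ (2 * k ^ 2) / r ^+ (2 * k).
  apply: (canRL (mulfK _)); first by rewrite expf_neq0 // gt_eqF.
  by rewrite -exprD; congr (_ ^+ _); rewrite bin2_sqr; lia.
have -> : r ^+ (6 * k) = r ^+ (2 * k) * r ^+ (4 * k) by rewrite -exprD; congr (_ ^+ _); lia.
have e2 : r ^+ (2 * k ^ 2) = r ^+ (k ^ 2) * r ^+ (k ^ 2) by rewrite -exprD; congr (_ ^+ _); lia.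
rewrite e e2 invfM.
set x := r ^+ (k ^ 2); set y := (r ^+ (2 * k))^-1; set w := (r ^+ (4 * k))^-1.
have x1 : x <= 1 by rewrite exprn_ile1 // ltW.
have x0 : 0 <= x by rewrite exprn_ge0 // ltW.
have y0 : 0 <= y by rewrite invr_ge0 exprn_ge0 // ltW.
have w0 : 0 <= w by rewrite invr_ge0 exprn_ge0 // ltW.
have -> : x * x * y * points_bound q alpha beta ^+ k * w =
  (points_bound q alpha beta ^+ k * (y * w) * x) * x by ring.
by rewrite ler_piMr // !mulr_ge0.
Qed.

Lemma printed_absurd : False.
Proof.
have [D hD] := evalue_bound.
apply: (@alternating_absurd R q c ca cb (moment_factor Q ca cb cc)
  (fun k => Q ^+ 'C(k, 2) * evalue k) D hq hc ha hb) => //.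
- by move=> m; rewrite /factor_ratio -hcc.
- exact: factor_sum.
Qed.

End Printed.

(** * Admissible parameters and configurations *)

Section Admissible.
Variables (R : realType) (q alpha beta : R) (gamma delta : R[i]).
Hypothesis hq : 0 < q < 1.
Hypothesis hadm : admissible q alpha beta gamma delta.

Lemma admissible_off_grid x : grid_ends q alpha beta x -> gamma != x%:C%C.
Proof.
move=> hx; case: hadm => _ _ [[_ im]|[g [d [a [b [-> _ [_ _ _ nb] gab _]]]]]].
  by apply: contra_neq im => ->.
apply/eqP => -[e]; move: hx; rewrite -e => /nb; exact.
Qed.

(** The product is |gamma|^2 in the conjugate case; in the real case gamma and delta have the same
    sign because 0 is an end of the grid intervals. *)
Lemma admissible_sum_prod : exists s p : R,
  [/\ gamma + delta = s%:C%C, gamma * delta = p%:C%C & 0 < p].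
Proof.
case: hadm => _ _ [[e im]|[g [d [a [b [-> -> [_ _ _ nb] /andP[ag gb] /andP[ad db]]]]]]].
  have -> : delta = (gamma^*)%C by rewrite e conjcK.
  have [x [y eg]] : exists x y, gamma = (x +i* y)%C by case: (gamma) => x y; exists x, y.
  move: im; rewrite eg /= => y0; exists (x + x), (x ^+ 2 + y ^+ 2); split.
  - by apply/eqP; rewrite eq_complex /= subrr !eqxx.
  - by apply/eqP; rewrite eq_complex /=; apply/andP; split; apply/eqP; ring.
  - by rewrite ltr_wpDl ?sqr_ge0 // lt0r sqrf_eq0 y0 sqr_ge0.
exists (g + d), (g * d); split; rewrite ?rmorphD ?rmorphM //.
have [a0|a0] := leP 0 a; first by rewrite mulr_gt0 // (le_lt_trans a0).
have [b0|b0] := leP b 0; first by rewrite nmulr_lgt0 (lt_le_trans _ b0).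
by have := nb 0 (or_introl erefl); rewrite a0 b0 => /(_ isT).
Qed.

(** A zero would put gamma at x q^-(m+1), an end of a grid interval. *)
Lemma admissible_factor (x : R) m : x != 0 ->
  grid_ends q alpha beta (x * q ^- m.+1) ->
  1 - gamma / (x%:C%C : R[i]) * (q%:C%C : R[i]) * (q%:C%C : R[i]) ^+ m != 0.
Proof.
move=> x0 /admissible_off_grid; apply: contra_neq.
have qm : (q%:C%C : R[i]) ^+ m.+1 != 0.
  by rewrite expf_neq0 // fmorph_eq0 gt_eqF //; case/andP: hq.
have xC : (x%:C%C : R[i]) != 0 by rewrite fmorph_eq0.
rewrite -(mulrA _ _ (_ ^+ m)) -exprS => /eqP; rewrite subr_eq0 => /eqP e.
rewrite rmorphM /= fmorphV rmorphXn /= -[x%:C%C]mulr1 e.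
by rewrite [in RHS](mulrA (x%:C%C)) [x%:C%C * _](mulrC) divfK // mulfK.
Qed.

End Admissible.

Lemma measurable_configuration (X : BorelOmega) : measurable [set X].
Proof.
rewrite -[[set X]]setCK; apply: measurableC; apply: sub_sigma_algebra.
have : closed [set (X : Omega)].
  apply: accessible_closed_set1; apply: hausdorff_accessible.
  by apply: hausdorff_product => i; exact: discrete_hausdorff.
exact: closed_openC.
Qed.

Lemma Omega_infty_full (R : realType) (M : probability BorelOmega R) :
  (forall X : BorelOmega, finite_set [set i | X i] -> M [set X] = 0%E) ->
  M Omega_infty = 1%E.
Proof.
move=> hM.
(* Finite configurations are coded by lists of grid points, a countable type. *)
pose conf (s : seq grid_index) : BorelOmega := fun i => i \in s.
pose F n := if unpickle n is Some s then [set conf s] else set0.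
have e : ~` Omega_infty = \bigcup_n F n.
  apply/seteqP; split => [X /contrapT /finite_seqP[s hs]|X [n _]].
    exists (pickle s) => //; rewrite /F pickleK; apply/funext => i.
    by have := congr1 (fun A => A i) hs; rewrite /= => {}hs; apply/idP/idP; rewrite hs.
  rewrite /F; case: unpickle => //= s ->; apply; exact: finite_seq.
have mF n : measurable (F n).
  by rewrite /F; case: unpickle => // s; exact: measurable_configuration.
have mI : measurable (~` Omega_infty) by rewrite e; apply: bigcup_measurable => n _.
have M0 : M (~` Omega_infty) = 0%E.
  apply: measure_negligible => //; rewrite e; apply: negligible_bigcup => n.
  apply/negligibleP => //; rewrite /F; case: unpickle => [s|]; last exact: measure0.
  by apply: hM; exact: finite_seq.
by rewrite -(setCK Omega_infty) probability_setC // M0 sube0.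
Qed.

Theorem theorem5p1 (R : realType) (q alpha beta : R) (gamma delta : R[i])
  (hq : 0 < q < 1) (hadm : admissible q alpha beta gamma delta)
  (M : probability BorelOmega R)
  (hM : orthogonal_basis M (Phi q alpha beta gamma delta) \/
        orthogonal_basis M (Phi_printed q alpha beta gamma delta)) :
  M Omega_infty = 1%E.
Proof.
have [q0 _] := andP hq.
have [alpha0 beta0 _] := hadm.
have aN0 : alpha != 0 by rewrite gt_eqF.
have bN0 : beta != 0 by rewrite lt_eqF.
have gamma0 : gamma != 0 by apply: (admissible_off_grid hadm (x := 0)); left.
have [s [p [hs hp p0]]] := admissible_sum_prod hadm.
have hc : p * (q / alpha * (q / beta)) < 0.
  by rewrite pmulr_rlt0 // pmulr_rlt0 ?divr_gt0 // pmulr_rlt0 // invr_lt0.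
apply: Omega_infty_full => X finX.
case: hM => hM.
  exact: (finite_mass0 hq aN0 bN0 gamma0 hs hp hc hM (measurable_configuration X) finX).
have ec : gamma * delta / (alpha%:C%C * beta%:C%C) * (q%:C%C : R[i]) ^+ 2
    = (p * (q / alpha * (q / beta)))%:C%C.
  by rewrite hp -rmorphM -fmorphV -rmorphXn -!rmorphM /=; congr (_%:C%C); field; rewrite aN0 bN0.
exfalso; apply: (printed_absurd hq hc gamma0 ec _ _ _ hM).
- move=> n; rewrite ec (rmorphM (real_complex R) p) (rmorphM (real_complex R) (q / alpha)).
  exact: (generic_qX hq hc).
- by move=> m; apply: (admissible_factor hq hadm) => //; right; exists m; left.
- by move=> m; apply: (admissible_factor hq hadm) => //; right; exists m; right.
Qed.
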